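(* Let $p$ be a prime, let $G$ be a non-trivial finite $p$-group and let $k$ be a field of characteristic $p$. The following statements are equivalent. (1) $G$ is isomorphic to $C_2$ or $C_3$. (2) There are no non-trivial ghosts in $\mathrm{stmod}(kG)$; that is, the generating hypothesis holds for $kG$. (3) There are no non-trivial ghosts in $\mathrm{StMod}(kG)$. (4) $\mathrm{stmod}(kG)$ is equivalent to its full subcategory consisting of the finite coproducts of suspensions of $k$ (that is, every object of $\mathrm{stmod}(kG)$ is isomorphic in $\mathrm{stmod}(kG)$ to a finite coproduct of suspensions of $k$). (5) $\mathrm{StMod}(kG)$ is equivalent to its full subcategory consisting of arbitrary coproducts of suspensions of $k$ (that is, every object of $\mathrm{StMod}(kG)$ is isomorphic in $\mathrm{StMod}(kG)$ to a coproduct of suspensions of $k$).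
   Context: All modules are left modules. $C_n$ denotes the cyclic group of order $n$. For a finite group $G$ and a field $k$ whose characteristic divides $|G|$, the stable module category $\mathrm{StMod}(kG)$ has as objects the $kG$-modules, and its morphism spaces are $\underline{\mathrm{Hom}}_{kG}(M,N)$, the $k$-vector space of $kG$-module homomorphisms $M\to N$ modulo those that factor through a projective $kG$-module. $\mathrm{stmod}(kG)$ is the category defined in the same way using only finite-dimensional $kG$-modules. $\Omega M$ denotes the kernel of a surjection from a projective module onto $M$; $\Omega$ is a self-equivalence of the stable category (the desuspension), so $\Omega^i$ is defined for all $i\in\mathbb{Z}$. The ''suspensions of $k$'' are the objects $\Omega^i k$, $i\in\mathbb{Z}$, where $k$ is the trivial $kG$-module. Coproducts in $\mathrm{StMod}(kG)$ are given by direct sums of modules. A map $\phi\colon M\to N$ is ''trivial'' if it is zero in the stable category, i.e. factors through a projective. It is a ''ghost'' if the induced map $\underline{\mathrm{Hom}}_{kG}(\Omega^i k,M)\to\underline{\mathrm{Hom}}_{kG}(\Omega^i k,N)$ is zero for every $i\in\mathbb{Z}$. For a finite $p$-group $G$ and a field $k$ of characteristic $p$, the generating hypothesis for $kG$ is the statement that every ghost between finite-dimensional $kG$-modules is trivial in $\mathrm{stmod}(kG)$. *)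

(* Defs.v *)
From HB Require Import structures.
From mathcomp Require Import all_boot all_order all_algebra all_fingroup.
From mathcomp Require Import all_solvable.
From mathcomp Require Import boolp classical_sets functions cardinality.

Set Implicit Arguments.
Unset Strict Implicit.
Unset Printing Implicit Defensive.

Import GRing.Theory.
Local Open Scope ring_scope.

(* The group algebra kG: functions G -> k under convolution.  The finite group
   G is the whole of the finGroupType gT. *)

Definition group_algebra (k : nzRingType) (gT : finGroupType) : Type :=
  {ffun gT -> k}.

Section GroupAlgebra.
Variables (k : comNzRingType) (gT : finGroupType).
Local Notation kG := (group_algebra k gT).

HB.instance Definition _ := GRing.Lmodule.copy kG {ffun gT -> k^o}.

Definition galg_one : kG := [ffun g : gT => (g == 1%g)%:R].
Definition galg_mul (a b : kG) : kG :=
  [ffun g : gT => \sum_(h : gT) a h * b (h^-1 * g)%g].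

Lemma galg_mulA : associative galg_mul.
Proof.
move=> a b c; apply/ffunP=> g; rewrite !ffunE.
under eq_bigr do rewrite ffunE big_distrr /=.
under [RHS]eq_bigr do rewrite ffunE big_distrl /=.
rewrite [RHS]exchange_big /=; apply: eq_bigr => h _.
rewrite [RHS](reindex_inj (mulgI h)) /=; apply: eq_bigr => u _.
by rewrite mulrA mulKg invMg mulgA.
Qed.

Lemma galg_mul1r : left_id galg_one galg_mul.
Proof.
move=> a; apply/ffunP=> g; rewrite !ffunE (bigD1 1%g) //= big1 => [|h h1].
  by rewrite ffunE eqxx mul1r invg1 mul1g addr0.
by rewrite ffunE (negPf h1) mul0r.
Qed.

Lemma galg_mulr1 : right_id galg_one galg_mul.
Proof.
move=> a; apply/ffunP=> g; rewrite !ffunE (bigD1 g) //= big1 => [|h hg].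
  by rewrite ffunE mulVg eqxx mulr1 addr0.
by rewrite ffunE -eq_mulVg1 (negPf hg) mulr0.
Qed.

Lemma galg_mulDl : left_distributive galg_mul +%R.
Proof.
move=> a b c; apply/ffunP=> g; rewrite !ffunE -big_split /=.
by apply: eq_bigr => h _; rewrite ffunE mulrDl.
Qed.

Lemma galg_mulDr : right_distributive galg_mul +%R.
Proof.
move=> a b c; apply/ffunP=> g; rewrite !ffunE -big_split /=.
by apply: eq_bigr => h _; rewrite ffunE mulrDr.
Qed.

Lemma galg_one_neq0 : galg_one != 0.
Proof.
by apply/eqP=> /ffunP/(_ 1%g); rewrite !ffunE eqxx => /eqP; rewrite oner_eq0.
Qed.

HB.instance Definition _ := GRing.Zmodule_isNzRing.Build kG
  galg_mulA galg_mul1r galg_mulr1 galg_mulDl galg_mulDr galg_one_neq0.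

Lemma galg_scaleAl (c : k) (a b : kG) : c *: (a * b) = (c *: a) * b.
Proof.
apply/ffunP=> g; rewrite !ffunE /= scaler_sumr.
by apply: eq_bigr => h _; rewrite ffunE; exact: mulrA.
Qed.

HB.instance Definition _ := GRing.Lmodule_isLalgebra.Build k kG galg_scaleAl.

Lemma galg_scaleAr (c : k) (a b : kG) : c *: (a * b) = a * (c *: b).
Proof.
apply/ffunP=> g; rewrite !ffunE /= scaler_sumr.
by apply: eq_bigr => h _; rewrite ffunE; exact: mulrCA.
Qed.

HB.instance Definition _ := GRing.Lalgebra_isAlgebra.Build k kG galg_scaleAr.

End GroupAlgebra.

(* The trivial module k: every g in G acts as the identity, so an element of
   kG acts through its augmentation. *)

Definition trivial_module (k : nzRingType) (gT : finGroupType) : Type := k.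

Section TrivialModule.
Variables (k : comNzRingType) (gT : finGroupType).
Local Notation kG := (group_algebra k gT).
Local Notation triv := (trivial_module k gT).

HB.instance Definition _ := GRing.Zmodule.on triv.

Definition augmentation (a : kG) : k := \sum_(g : gT) (a : {ffun gT -> k}) g.
Definition triv_scale (a : kG) (x : triv) : triv := augmentation a * (x : k).

Lemma triv_scaleA a b x : triv_scale a (triv_scale b x) = triv_scale (a * b) x.
Proof.
rewrite /triv_scale mulrA; congr (_ * _); rewrite /augmentation.
under [RHS]eq_bigr do rewrite ffunE.
rewrite exchange_big big_distrl /=; apply: eq_bigr => h _.
by rewrite (reindex_inj (mulgI h^-1%g)) -big_distrr.
Qed.

Lemma triv_scale1 : left_id 1 triv_scale.
Proof.
move=> x; rewrite /triv_scale /augmentation (bigD1 1%g) //= big1 => [|g g1].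
  by rewrite ffunE eqxx addr0 mul1r.
by rewrite ffunE (negPf g1).
Qed.

Lemma triv_scaleDr : right_distributive triv_scale +%R.
Proof. by move=> a x y; rewrite /triv_scale -mulrDr. Qed.

Lemma triv_scaleDl x : {morph triv_scale^~ x : a b / a + b}.
Proof.
move=> a b; rewrite /triv_scale -mulrDl; congr (_ * _).
by rewrite /augmentation -big_split; apply: eq_bigr => g _; rewrite ffunE.
Qed.

HB.instance Definition _ := GRing.Zmodule_isLmodule.Build kG triv
  triv_scaleA triv_scale1 triv_scaleDr triv_scaleDl.

End TrivialModule.

Definition restrict_scalars (k : nzRingType) (A : lalgType k) (M : lmodType A)
  : Type := M.

Section RestrictScalars.
Variables (k : nzRingType) (A : lalgType k) (M : lmodType A).
Local Notation Mk := (restrict_scalars M).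

HB.instance Definition _ := GRing.Zmodule.on Mk.

Definition restr_scale (c : k) (x : Mk) : Mk := c%:A *: (x : M).

Lemma restr_scaleA c d x : restr_scale c (restr_scale d x) = restr_scale (c * d) x.
Proof. by rewrite /restr_scale scalerA -scalerAl mul1r scalerA. Qed.

Lemma restr_scale1 : left_id 1 restr_scale.
Proof. by move=> x; rewrite /restr_scale !scale1r. Qed.

Lemma restr_scaleDr : right_distributive restr_scale +%R.
Proof. by move=> c x y; rewrite /restr_scale scalerDr. Qed.

Lemma restr_scaleDl x : {morph restr_scale^~ x : c d / c + d}.
Proof. by move=> c d; rewrite /restr_scale !scalerDl. Qed.

HB.instance Definition _ := GRing.Zmodule_isLmodule.Build k Mk
  restr_scaleA restr_scale1 restr_scaleDr restr_scaleDl.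

Definition finite_dimensional : Prop :=
  exists (n : nat) (f : {linear Mk -> 'rV[k]_n}), bijective f.

End RestrictScalars.

(* Direct products and direct sums (the finitely supported families) of
   modules, over an arbitrary index type. *)

Definition dprod_module (R : nzRingType) (I : Type) (M : I -> lmodType R)
  : Type := forall i, M i.

Section DirectProduct.
Variables (R : nzRingType) (I : Type) (M : I -> lmodType R).
Local Notation P := (dprod_module M).

HB.instance Definition _ := gen_eqMixin P.
HB.instance Definition _ := gen_choiceMixin P.

Definition dprod_zero : P := fun i => 0.
Definition dprod_opp (x : P) : P := fun i => - x i.
Definition dprod_add (x y : P) : P := fun i => x i + y i.
Definition dprod_scale (a : R) (x : P) : P := fun i => a *: x i.

Lemma dprod_addA : associative dprod_add.
Proof. by move=> x y z; apply: functional_extensionality_dep=> i; apply: addrA. Qed.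
Lemma dprod_addC : commutative dprod_add.
Proof. by move=> x y; apply: functional_extensionality_dep=> i; apply: addrC. Qed.
Lemma dprod_add0 : left_id dprod_zero dprod_add.
Proof. by move=> x; apply: functional_extensionality_dep=> i; apply: add0r. Qed.
Lemma dprod_addN : left_inverse dprod_zero dprod_opp dprod_add.
Proof. by move=> x; apply: functional_extensionality_dep=> i; apply: addNr. Qed.

HB.instance Definition _ := GRing.isZmodule.Build P
  dprod_addA dprod_addC dprod_add0 dprod_addN.

Lemma dprod_scaleA a b x : dprod_scale a (dprod_scale b x) = dprod_scale (a * b) x.
Proof. by apply: functional_extensionality_dep=> i; apply: scalerA. Qed.
Lemma dprod_scale1 : left_id 1 dprod_scale.
Proof. by move=> x; apply: functional_extensionality_dep=> i; apply: scale1r. Qed.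
Lemma dprod_scaleDr : right_distributive dprod_scale +%R.
Proof. by move=> a x y; apply: functional_extensionality_dep=> i; apply: scalerDr. Qed.
Lemma dprod_scaleDl x : {morph dprod_scale^~ x : a b / a + b}.
Proof. by move=> a b; apply: functional_extensionality_dep=> i; apply: scalerDl. Qed.

HB.instance Definition _ := GRing.Zmodule_isLmodule.Build R P
  dprod_scaleA dprod_scale1 dprod_scaleDr dprod_scaleDl.

Definition finitely_supported : {pred P} :=
  fun x => `[< finite_set [set i | x i != 0] >].

Lemma finitely_supported_submod : submod_closed finitely_supported.
Proof.
split=> [|a x y /asboolP xfin /asboolP yfin]; apply/asboolP.
  apply: (sub_finite_set (B := set0)) => [i /=|]; last exact: finite_set0.
  by rewrite eqxx.
apply: (sub_finite_set (B := [set i | x i != 0] `|` [set i | y i != 0]))%classic.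
  move=> i /= axy; case: (eqVneq (x i) 0) => [xi0|]; [right | by left].
  apply: contra axy => /eqP yi0; apply/eqP.
  by change (a *: x i + y i = 0); rewrite [x i]xi0 [y i]yi0 scaler0 addr0.
by rewrite finite_setU.
Qed.

HB.instance Definition _ :=
  GRing.isSubmodClosed.Build R P finitely_supported finitely_supported_submod.

End DirectProduct.

Record direct_sum (R : nzRingType) (I : Type) (M : I -> lmodType R) : Type :=
  DirectSum {
    dsum_family :> dprod_module M;
    dsum_finite : dsum_family \in @finitely_supported R I M
  }.

Section DirectSum.
Variables (R : nzRingType) (I : Type) (M : I -> lmodType R).

HB.instance Definition _ := [isSub for @dsum_family R I M].
HB.instance Definition _ := [Choice of direct_sum M by <:].
HB.instance Definition _ := [SubChoice_isSubLmodule of direct_sum M by <:].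

End DirectSum.

(* The stable category of R-modules with objects restricted to a class obj.
   For R = kG, obj := all_modules gives StMod(kG) and
   obj := finite_dimensional gives stmod(kG). *)

Definition all_modules (R : nzRingType) : lmodType R -> Prop := fun=> True.

Definition projective (R : nzRingType) (P : lmodType R) : Prop :=
  forall (M N : lmodType R) (q : {linear M -> N}) (f : {linear P -> N}),
    (forall y, exists x, q x = y) ->
    exists h : {linear P -> M}, forall x, q (h x) = f x.

Section StableCategory.
Variables (R : nzRingType) (obj : lmodType R -> Prop).

Definition stably_trivial (M N : lmodType R) (f : {linear M -> N}) : Prop :=
  exists P : lmodType R, [/\ obj P, projective P &
    exists (a : {linear M -> P}) (b : {linear P -> N}), forall x, f x = b (a x)].

Definition stably_equal (M N : lmodType R) (f g : {linear M -> N}) : Prop :=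
  stably_trivial (f \- g).

Definition stably_isomorphic (M N : lmodType R) : Prop :=
  exists (f : {linear M -> N}) (g : {linear N -> M}),
    stably_equal (g \o f) idfun /\ stably_equal (f \o g) idfun.

(* K is the kernel of a surjection from a projective module onto M. *)
Definition is_Omega (M K : lmodType R) : Prop :=
  exists P : lmodType R, [/\ obj P, obj K, projective P &
    exists (j : {linear K -> P}) (q : {linear P -> M}),
      [/\ injective j, forall y, exists x, q x = y
        & forall x, q x = 0 <-> exists z, j z = x]].

(* Omega is only well defined up to stable isomorphism, so its powers are
   relations: is_Omega_iter i M X says that X is a representative of
   Omega^i M.  Negative powers use that Omega is a self-equivalence:
   X represents Omega^-n M when Omega^n X is stably isomorphic to M. *)
Fixpoint is_Omega_iter_nat (n : nat) (M X : lmodType R) : Prop :=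
  if n is n'.+1 then
    exists Y : lmodType R, is_Omega M Y /\ is_Omega_iter_nat n' Y X
  else stably_isomorphic M X.

Definition is_Omega_iter (i : int) (M X : lmodType R) : Prop :=
  match i with
  | Posz n => is_Omega_iter_nat n M X
  | Negz n => is_Omega_iter_nat n.+1 X M
  end.

End StableCategory.

Section Ghosts.
Variables (k : fieldType) (gT : finGroupType).
Local Notation kG := (group_algebra k gT).
Variable obj : lmodType kG -> Prop.

Definition suspension_of_k (i : int) (X : lmodType kG) : Prop :=
  obj X /\ is_Omega_iter obj i (trivial_module k gT) X.

Definition ghost (M N : lmodType kG) (phi : {linear M -> N}) : Prop :=
  forall (i : int) (X : lmodType kG), suspension_of_k i X ->
  forall f : {linear X -> M}, stably_trivial obj (phi \o f).

Definition no_nontrivial_ghosts : Prop :=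
  forall (M N : lmodType kG), obj M -> obj N ->
  forall phi : {linear M -> N}, ghost phi -> stably_trivial obj phi.

Definition coproduct_of_suspensions (I : Type) (M : lmodType kG) : Prop :=
  exists X : I -> lmodType kG,
    (forall j, exists i : int, suspension_of_k i (X j))
    /\ stably_isomorphic obj M (direct_sum X).

End Ghosts.

Definition stmod (k : fieldType) (gT : finGroupType) :
  lmodType (group_algebra k gT) -> Prop :=
  @finite_dimensional k (group_algebra k gT).

Definition StMod (k : fieldType) (gT : finGroupType) :
  lmodType (group_algebra k gT) -> Prop :=
  @all_modules (group_algebra k gT).

Arguments stmod k gT M : clear implicits.
Arguments StMod k gT M : clear implicits.

Definition generating_hypothesis (k : fieldType) (gT : finGroupType) : Prop :=
  no_nontrivial_ghosts (stmod k gT).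

(* Main.v *)
Require Import Defs.
From HB Require Import structures.
From mathcomp Require Import all_boot all_order all_algebra all_fingroup.
From mathcomp Require Import all_solvable.
From mathcomp Require Import boolp classical_sets functions cardinality fsbigop.
From mathcomp Require Import ring.

(* Let H be a subgroup of G and h a central element of H.  Multiplication by
   h^-1 - 1 is zero on k, and Omega is functorial, so on every suspension X of k
   it is stably zero over H: it is a trace sum_(u in H) u psi u^-1 for some
   k-linear psi.  Given a homomorphism lam : H -> k with lam h = 1, the functions
   F on G with u |-> F (g u) an affine function of lam u on every coset g H form a
   kG-module, namely the module induced from a two-dimensional kH-module on
   which h - 1 acts as a nonzero nilpotent N.  The map induced by N is a ghost
   by Frobenius reciprocity.  It is not a trace, hence not stably trivial, as soon as
   the sums over H of 1, lam and lam^2 vanish in k.  If G is neither C_2 nor C_3 this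
   is achieved by a subgroup H of order p^2, or by H = G of order p >= 5.

   Conversely, if G is generated by h of order p <= 3, then x = h - 1 satisfies
   x^p = 0, and a module is a sum of Jordan blocks k[x]/x^i with i <= p.  The
   blocks of size p are free, those of size 1 are k, and for p = 3 those of size 2 are
   Omega^-1 k. *)

Set Implicit Arguments.
Unset Strict Implicit.
Unset Printing Implicit Defensive.

Import GRing.Theory.
Local Open Scope ring_scope.

(** Being a trace over G replaces factoring through a projective throughout. The two agree for maps
    into an object of [obj] as soon as [obj] is closed under [coinduced], so stmod and StMod are
    treated by one argument. A trace only involves k-linear data, which exists by linear algebra
    (retractions, sections, projections), and it restricts to subgroups without changing the group
    algebra. The sums of 1, lam and lam^2 arise as follows. Apply a hypothetical trace to the
    function equal to lam on H and 0 elsewhere, and evaluate at 1: each coset of H contributes the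
    sum over u in H of a polynomial of degree at most 2 in lam u, whereas the ghost itself has value
    1 there. If H has order p, lam runs over the prime field, where the sum of e-th powers for e > 0
    vanishes unless p - 1 divides e; for e = 1, 2 the exceptions are exactly p = 2 and p = 3. If H
    has order p^2, lam takes each of its values p times, so the sums vanish for every p. *)

(** * Direct sums *)

Definition mklin (R : nzRingType) (M N : lmodType R) (f : M -> N)
    (f_lin : linear f) : {linear M -> N} :=
  let F := GRing.isLinear.Build R M N *:%R f f_lin in
  HB.pack_for {linear M -> N} f F.

Lemma mklinE (R : nzRingType) (M N : lmodType R) (f : M -> N)
    (f_lin : linear f) x : mklin f_lin x = f x.
Proof. by []. Qed.

Section DirectSums.
Variables (R : nzRingType) (I : Type) (M : I -> lmodType R).
Implicit Types (F : direct_sum M) (N : zmodType).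

Definition dval F (i : I) : M i := dsum_family F i.

Lemma dsum_ext F F' : (forall i, dval F i = dval F' i) -> F = F'.
Proof. by move=> eqF; apply/val_inj/functional_extensionality_dep. Qed.

Lemma dsum_finite_supp F : finite_set [set i | dval F i != 0].
Proof. by have /asboolP := dsum_finite F. Qed.

Lemma dsum_mk (F : forall i, M i) :
  finite_set [set i | F i != 0] -> exists F' : direct_sum M, forall i, dval F' i = F i.
Proof.
move=> Ffin; have Fin : (F : dprod_module M) \in @finitely_supported R I M.
  exact/asboolP.
by exists (DirectSum Fin).
Qed.

Lemma dsumD F F' i : dval (F + F') i = dval F i + dval F' i. Proof. by []. Qed.
Lemma dsumB F F' i : dval (F - F') i = dval F i - dval F' i. Proof. by []. Qed.
Lemma dsumZ a F i : dval (a *: F) i = a *: dval F i. Proof. by []. Qed.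
Lemma dsum0 i : dval (0 : direct_sum M) i = 0. Proof. by []. Qed.

(** Equality on [I] is decided classically, and the transport along [i = j] disappears by proof
    irrelevance. *)
Definition dsum_in_fun (i : I) (x : M i) : forall j, M j := fun j =>
  if pselect (i = j) is left e then eq_rect _ (fun j => M j) x j e else 0.

Lemma dsum_in_same i (x : M i) : dsum_in_fun x i = x.
Proof.
rewrite /dsum_in_fun; case: pselect => // e.
by rewrite (Prop_irrelevance e erefl).
Qed.

Lemma dsum_in_diff i j (x : M i) : i <> j -> dsum_in_fun x j = 0.
Proof. by rewrite /dsum_in_fun; case: pselect. Qed.

Lemma dsum_in_finite i (x : M i) :
  finite_set [set j | dsum_in_fun x j != 0].
Proof.
apply: (sub_finite_set (B := [set i])%classic) => [j /=|]; last exact: finite_set1.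
by apply: contraNP => /nesym/dsum_in_diff ->.
Qed.

Definition dsum_in i (x : M i) : direct_sum M := sval (cid (dsum_mk (dsum_in_finite x))).

Lemma dsum_inE i (x : M i) j : dval (dsum_in x) j = dsum_in_fun x j.
Proof. by rewrite /dsum_in; case: cid. Qed.

Lemma dsum_in_linear i : linear (@dsum_in i).
Proof.
move=> a x y; apply: dsum_ext => j; rewrite dsumD dsumZ !dsum_inE.
have [ij|ij] := pselect (i = j); first by subst j; rewrite !dsum_in_same.
by rewrite !dsum_in_diff // scaler0 addr0.
Qed.

(** Induction on a list containing the support, removing one coordinate at a time. *)
Lemma dsum_ind (P : direct_sum M -> Prop) :
  P 0 -> (forall F F', P F -> P F' -> P (F + F')) ->
  (forall i x, P (@dsum_in i x)) -> forall F, P F.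
Proof.
move=> P0 PD Pin F.
have [s Fs] : exists s : seq {classic I}, forall i : I, dval F i != 0 -> (i : {classic I}) \in s.
  have /(finite_seqP (T := {classic I})) [s Es] := dsum_finite_supp F.
  exists s => i Fi; have : ([set i : I | dval F i != 0])%classic i by [].
  by rewrite Es.
elim: s F Fs => [|i s IHs] F Fs.
  suff -> : F = 0 by [].
  apply: dsum_ext => i; rewrite dsum0; apply/eqP; apply: contraT.
  by move=> /Fs.
rewrite -[F](subrK (dsum_in (dval F i))); apply: PD; last exact: Pin.
apply: IHs => j; rewrite dsumB dsum_inE.
have [ij|ij] := pselect ((i : I) = j).
  by subst j; rewrite dsum_in_same subrr eqxx.
rewrite dsum_in_diff // subr0 => /Fs; rewrite inE => /orP[/eqP ji|//].
by case: ij.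
Qed.

Section Lift.
Variables (N : zmodType) (f : forall i, M i -> N).
Hypothesis fD : forall i x y, f (x + y : M i) = f x + f y.

(** Only additivity of the [f i] is used, because the k-linear maps that define traces must be glued
    on direct sums of kG-modules. *)
Definition dsum_lift F : N := \sum_(i \in [set: {classic I}]%classic) f (dval F i).

Lemma dsum_lift_f0 i : f (0 : M i) = 0.
Proof. by apply: (addrI (f (0 : M i))); rewrite -fD !addr0. Qed.

Lemma dsum_lift_finite F (P : set {classic I}) :
  finite_set P -> (forall i : I, dval F i != 0 -> P i) ->
  dsum_lift F = \sum_(i \in P) f (dval F i).
Proof.
move=> Pfin FP; apply/esym/fsbig_widen => // i /= [_ iP].
have -> : dval F i = 0 by apply/eqP; apply: contraT => /FP.
exact: dsum_lift_f0.
Qed.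

Lemma dsum_liftD F F' : dsum_lift (F + F') = dsum_lift F + dsum_lift F'.
Proof.
pose P := ([set i : {classic I} | dval F i != 0] `|`
  [set i : {classic I} | dval F' i != 0])%classic.
have Pfin : finite_set P by rewrite finite_setU; split; exact: dsum_finite_supp.
have PF (i : I) : dval F i != 0 -> P i by move=> Fi; left.
have PF' (i : I) : dval F' i != 0 -> P i by move=> Fi; right.
have PD (i : I) : dval (F + F') i != 0 -> P i.
  rewrite dsumD; have [->|/PF//] := eqVneq (dval F i) 0.
  by rewrite add0r => /PF'.
rewrite (dsum_lift_finite Pfin PD) (dsum_lift_finite Pfin PF).
rewrite (dsum_lift_finite Pfin PF').
by rewrite -fsbig_split //; apply: eq_fsbigr => i _; exact: fD.
Qed.

Lemma dsum_lift_in i (x : M i) : dsum_lift (dsum_in x) = f x.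
Proof.
rewrite (@dsum_lift_finite _ [set (i : {classic I})]%classic) //; last first.
  by move=> j; rewrite dsum_inE; apply: contraNP => /nesym/dsum_in_diff ->.
by rewrite fsbig_set1 dsum_inE dsum_in_same.
Qed.

End Lift.
End DirectSums.

(* Commutation with arbitrary operators is how linearity of a map out of a
   direct sum is checked, over whichever ring. *)
Lemma dsum_lift_comm (R : nzRingType) (I : Type) (M : I -> lmodType R)
    (N : zmodType) (f : forall i, M i -> N) (a : R) (b : N -> N) :
  (forall i x y, f i (x + y) = f i x + f i y) ->
  (forall x y, b (x + y) = b x + b y) ->
  (forall i x, f i (a *: x) = b (f i x)) ->
  forall F, dsum_lift f (a *: F) = b (dsum_lift f F).
Proof.
move=> fD bD fab; have b0 : b 0 = 0 by apply: (addrI (b 0)); rewrite -bD !addr0.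
have L0 : dsum_lift f 0 = 0.
  by apply: (addrI (dsum_lift f 0)); rewrite -dsum_liftD // !addr0.
apply: dsum_ind => [|F F' HF HF'|i x]; first by rewrite scaler0 L0 b0.
  by rewrite scalerDr !dsum_liftD // bD HF HF'.
suff -> : a *: dsum_in x = dsum_in (a *: x) by rewrite !dsum_lift_in // fab.
have in0 : dsum_in (0 : M i) = 0.
  apply: dsum_ext => j; rewrite dsum_inE dsum0.
  have [ij|ij] := pselect (i = j); first by subst j; rewrite dsum_in_same.
  by rewrite dsum_in_diff.
by have := dsum_in_linear a x 0; rewrite in0 !addr0.
Qed.

(** * Bases of vector spaces *)

Definition free_space (k : fieldType) (I : Type) : lmodType k :=
  direct_sum (fun _ : I => k^o : lmodType k).

Section Bases.
Variables (k : fieldType) (V : lmodType k).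
Implicit Types (S U X : V -> Prop).

Definition subspace S := S 0 /\ forall c u v, S u -> S v -> S (c *: u + v).

Lemma subspaceD S : subspace S -> forall u v, S u -> S v -> S (u + v).
Proof. by move=> [_ SD] u v Su Sv; rewrite -[u]scale1r; exact: SD. Qed.

Lemma subspaceZ S : subspace S -> forall c u, S u -> S (c *: u).
Proof. by move=> [S0 SD] c u Su; rewrite -[_ *: _]addr0; exact: SD. Qed.

Lemma subspaceB S : subspace S -> forall u v, S u -> S v -> S (u - v).
Proof.
move=> Ssub u v Su Sv; apply: subspaceD => //.
by rewrite -scaleN1r; exact: subspaceZ.
Qed.

Definition span X v := forall S, subspace S -> (forall x, X x -> S x) -> S v.

Lemma span_subspace X : subspace (span X).
Proof.
split=> [S [S0 _]//|c u v Xu Xv S Ssub XS].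
by case: (Ssub) => _; apply; [exact: Xu|exact: Xv].
Qed.

Lemma span_gen X x : X x -> span X x. Proof. by move=> Xx S _; exact. Qed.

Lemma span_min X S : subspace S -> (forall x, X x -> S x) ->
  forall v, span X v -> S v.
Proof. by move=> Ssub XS v; apply. Qed.

Lemma span_sub X Y : (forall x, X x -> span Y x) ->
  forall v, span X v -> span Y v.
Proof. by move=> XY v; apply: span_min => //; exact: span_subspace. Qed.

Variable U : V -> Prop.
Hypothesis Usub : subspace U.

Local Notation others B b := (span (fun v => U v \/ B v /\ v <> b)).

(** Exchange argument: a dependency of an old [b] on the enlarged set puts some b - c v in the span
    of [U] and the other old vectors. If c = 0 this contradicts independence of [B]; otherwise [v]
    was already in the span. *)
Lemma independent_extend (B : V -> Prop) v :
  (forall b, B b -> ~ others B b b) -> ~ span (fun w => U w \/ B w) v ->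
  forall b, B b \/ b = v -> ~ others (fun w => B w \/ w = v) b b.
Proof.
move=> Bind Nv b B'b; have [bv|bv] := pselect (b = v).
  subst b => Bv; apply: Nv; move: Bv; apply: span_sub => w.
  by move=> [Uw|[[Bw|//] _]]; apply: span_gen; [left|right].
have {B'b} Bb : B b by case: B'b.
suff main w : others (fun w => B w \/ w = v) b w ->
    exists c, others B b (w - c *: v).
  move=> /main [c]; have [->|c0] := eqVneq c 0.
    by rewrite scale0r subr0; exact: Bind.
  move=> bc; apply: Nv; have Ssub := span_subspace (fun w => U w \/ B w).
  have -> : v = c^-1 *: (b - (b - c *: v)).
    by rewrite subKr scalerA mulVf // scale1r.
  apply: (subspaceZ Ssub); apply: (subspaceB Ssub).
    by apply: span_gen; right.
  move: bc; apply: span_sub => u; case=> [Uu|[Bu _]]; apply: span_gen; first by left.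
  by right.
have [S0 SD] := span_subspace (fun v => U v \/ B v /\ v <> b).
move: w; apply: span_min.
  split; first by exists 0; rewrite scale0r subrr.
  move=> a u u' [c Sc] [c' Sc']; exists (a * c + c').
  have -> : a *: u + u' - (a * c + c') *: v = a *: (u - c *: v) + (u' - c' *: v).
    by rewrite scalerBr scalerA scalerDl opprD addrACA.
  exact: SD.
move=> w [Uw|[[Bw|->] wb]].
+ by exists 0; rewrite scale0r subr0; apply: span_gen; left.
+ by exists 0; rewrite scale0r subr0; apply: span_gen; right.
+ by exists 1; rewrite scale1r subrr.
Qed.

(** Zorn's lemma for sets independent modulo [U]. A dependency in the union of a chain already
    occurs in one member: the vectors lying in the span attached to some member form a subspace,
    since the members are nested. *)
Lemma independent_complement : exists B : V -> Prop,
  (forall b, B b -> ~ others B b b) /\ (forall v, span (fun w => U w \/ B w) v).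
Proof.
pose P (B : set V) := forall b, B b -> ~ others B b b.
have [F FP Ftot|B [PB Bmax]] := @Zorn_bigcup V P.
  move=> b [C0 FC0 C0b].
  suff main w : others (\bigcup_(X in F) X)%classic b w ->
      exists C, [/\ F C, C b & others C b w].
    by move=> /main [C [FC Cb]]; exact: FP.
  have mono C C' u : (C `<=` C')%classic -> others C b u -> others C' b u.
    move=> CC'; apply: span_sub => x [Ux|[Cx xb]]; apply: span_gen; [by left|right; split=> //].
    exact: CC'.
  have osub C : subspace (others C b) by exact: span_subspace.
  move: w; apply: span_min.
    split=> [|c u v [C [FC Cb Cu]] [C' [FC' C'b C'v]]].
      by exists C0; split=> //; case: (osub C0).
    have [CC'|C'C] := Ftot _ _ FC FC'.
      exists C'; split=> //; case: (osub C') => _; apply=> //; exact: mono Cu.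
    exists C; split=> //; case: (osub C) => _; apply=> //; exact: mono C'v.
  move=> x [Ux|[[C FC Cx] xb]].
    by exists C0; split=> //; apply: span_gen; left.
  have [CC0|C0C] := Ftot _ _ FC FC0.
    by exists C0; split=> //; apply: span_gen; right; split=> //; exact: CC0.
  by exists C; split=> //; [exact: C0C|apply: span_gen; right].
exists B; split=> // v; apply: contrapT => Nv.
apply: (Bmax (fun w => B w \/ w = v)); last exact: independent_extend.
split; first by move=> w Bw; left.
by move=> /(_ v (or_intror erefl)) Bv; apply: Nv; apply: span_gen; right.
Qed.

(** A basis of V/U given by lifts [beta] and coordinates [gamma]. All the linear algebra below comes
    from it: U = 0 gives bases, an image or a kernel gives retractions and sections, and three
    successive choices of [U] give Jordan blocks. *)
Lemma basis_mod : exists (I : Type) (beta : {linear free_space k I -> V})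
    (gamma : {linear V -> free_space k I}),
  [/\ cancel beta gamma, forall u, U u -> gamma u = 0 &
      forall v, U (v - beta (gamma v))].
Proof.
have [B [Bind Bspan]] := independent_complement.
pose I := {b : V | B b}; pose S (i : I) := others B (sval i).
have Ssub i : subspace (S i) by exact: span_subspace.
(* The coordinate of [v] along a basis vector is the multiple to subtract in order to land in the
   span of [U] and the other basis vectors; it is unique by independence. *)
have coord_ex (i : I) v : exists c : k, S i (v - c *: sval i).
  move: v (Bspan v); apply: span_min.
    split; first by exists 0; rewrite scale0r subrr; case: (Ssub i).
    move=> a w w' [c Sc] [c' Sc']; exists (a * c + c').
    have -> : a *: w + w' - (a * c + c') *: sval i =
              a *: (w - c *: sval i) + (w' - c' *: sval i).
      by rewrite scalerBr scalerA scalerDl opprD addrACA.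
    by case: (Ssub i) => _; apply.
  move=> w [Uw|Bw].
    by exists 0; rewrite scale0r subr0; apply: span_gen; left.
  have [->|wi] := pselect (w = sval i).
    by exists 1; rewrite scale1r subrr; case: (Ssub i).
  by exists 0; rewrite scale0r subr0; apply: span_gen; right.
pose coord i v : k := sval (cid (coord_ex i v)).
have coordP i v : S i (v - coord i v *: sval i) by rewrite /coord; case: cid.
have coord_uniq i v c : S i (v - c *: sval i) -> coord i v = c.
  move=> Sc; apply/eqP; rewrite -subr_eq0; apply: contraT => cc.
  suff Sii : S i (sval i) by case: (Bind _ (svalP i)).
  rewrite -[X in S i X]scale1r -(mulVf cc) -scalerA.
  apply: (subspaceZ (Ssub i)); rewrite scalerBl.
  have -> : coord i v *: sval i - c *: sval i =
            (v - c *: sval i) - (v - coord i v *: sval i).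
    by rewrite [RHS]addrC opprB addrA subrK.
  exact: (subspaceB (Ssub i)).
have coord_lin i c v w : coord i (c *: v + w) = c * coord i v + coord i w.
  apply: coord_uniq.
  have -> : c *: v + w - (c * coord i v + coord i w) *: sval i =
            c *: (v - coord i v *: sval i) + (w - coord i w *: sval i).
    by rewrite scalerBr scalerA scalerDl opprD addrACA.
  by case: (Ssub i) => _; apply.
have coordU i u : U u -> coord i u = 0.
  by move=> Uu; apply: coord_uniq; rewrite scale0r subr0; apply: span_gen; left.
have coord1 i : coord i (sval i) = 1.
  by apply: coord_uniq; rewrite scale1r subrr; case: (Ssub i).
have coord0 i j : i <> j -> coord i (sval j) = 0.
  move=> ij; apply: coord_uniq; rewrite scale0r subr0; apply: span_gen; right.
  split; first exact: svalP.
  move=> ji; apply: ij; case: i j ji => [b Bb] [b' Bb'] /= e; subst b'.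
  by rewrite (Prop_irrelevance Bb Bb').
have coord_fin v : finite_set [set i | coord i v != 0].
  move: v (Bspan v); apply: span_min.
    split.
      apply: (sub_finite_set (B := set0)) => [i /=|]; last exact: finite_set0.
      by rewrite coordU ?eqxx //; case: Usub.
    move=> c u v ufin vfin.
    apply: (sub_finite_set (B := [set i | coord i u != 0] `|` [set i | coord i v != 0]))%classic.
      move=> i /=; rewrite coord_lin; have [->|] := eqVneq (coord i u) 0; last by left.
      by rewrite mulr0 add0r; right.
    by rewrite finite_setU.
  move=> w [Uw|Bw].
    apply: (sub_finite_set (B := set0)) => [i /=|]; last exact: finite_set0.
    by rewrite coordU ?eqxx.
  apply: (sub_finite_set (B := [set (exist _ w Bw : I)])%classic) => [i /=|].
    by apply: contraNP => iw; rewrite -[w]/(sval (exist _ w Bw : I)) coord0.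
  exact: finite_set1.
pose g v : free_space k I := sval (cid (dsum_mk (M := fun _ : I => k^o) (coord_fin v))).
have gE v i : dval (g v) i = coord i v by rewrite /g; case: cid.
have g_lin : linear g.
  by move=> c u v; apply: dsum_ext => i; rewrite dsumD dsumZ !gE coord_lin.
pose bf (i : I) (c : k^o) := c *: sval i.
have bfD i (x y : k^o) : bf i (x + y) = bf i x + bf i y by exact: scalerDl.
have b_lin : linear (dsum_lift bf : free_space k I -> V).
  move=> c F F'; rewrite dsum_liftD //; congr (_ + _).
  apply: (@dsum_lift_comm _ _ _ _ bf c (fun v => c *: v)) => // [x y|i x].
    exact: scalerDr.
  by rewrite /bf scalerA.
have gb (i : I) : g (sval i) = @dsum_in k I (fun=> k^o) i 1.
  apply: dsum_ext => j; rewrite gE dsum_inE.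
  have [ij|ij] := pselect (i = j).
    by subst j; rewrite dsum_in_same coord1.
  by rewrite dsum_in_diff // coord0 //; exact/nesym.
exists I, (mklin b_lin), (mklin g_lin); split.
- move=> F; rewrite !mklinE; elim/dsum_ind: F => [|F F' HF HF'|i x].
  + have -> : dsum_lift bf 0 = 0 by exact: (raddf0 (mklin b_lin)).
    exact: (raddf0 (mklin g_lin)).
  + by rewrite dsum_liftD // -[in RHS]HF -[in RHS]HF'; exact: (raddfD (mklin g_lin)).
  + rewrite dsum_lift_in // /bf.
    have -> : g (x *: sval i) = x *: g (sval i) by exact: (linearZ_LR (mklin g_lin)).
    rewrite gb.
    apply: dsum_ext => j; rewrite dsumZ !dsum_inE.
    have [ij|ij] := pselect (i = j).
      by subst j; rewrite !dsum_in_same; exact: mulr1.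
    by rewrite !dsum_in_diff // scaler0.
- by move=> u Uu; apply: dsum_ext => i; rewrite mklinE gE coordU.
move=> v; move: v (Bspan v); apply: span_min.
  case: (Usub) => U0 UD; split; first by rewrite !linear0 ?subr0 ?addr0.
  move=> c u v Uu Uv; rewrite (linearP (mklin g_lin)) (linearP (mklin b_lin)).
  by rewrite opprD addrACA -scalerBr; exact: UD.
move=> w [Uw|Bw].
  suff -> : mklin g_lin w = 0 by rewrite raddf0 subr0.
  by apply: dsum_ext => i; rewrite mklinE gE coordU.
rewrite !mklinE -[w]/(sval (exist _ w Bw : I)) gb dsum_lift_in // /bf.
by rewrite scale1r subrr; case: Usub.
Qed.

End Bases.

(** Take [U] to be the image of [j]: subtracting the component along the complement lands in that
    image, where [j] can be inverted. *)
Lemma linear_retraction (k : fieldType) (V W : lmodType k)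
    (j : {linear V -> W}) : injective j ->
  exists r : {linear W -> V}, cancel j r.
Proof.
move=> jinj; have Usub : subspace (fun w => exists v, j v = w).
  split; first by exists 0; exact: raddf0.
  by move=> c _ _ [u <-] [v <-]; exists (c *: u + v); rewrite linearP.
have [I [b [g [bg gU Ub]]]] := basis_mod Usub.
pose r w := sval (cid (Ub w)).
have rP w : j (r w) = w - b (g w) by rewrite /r; case: cid.
have r_lin : linear r.
  move=> c u v; apply: jinj; rewrite linearP !rP (linearP g) (linearP b) opprD addrACA.
  by rewrite -scalerBr.
exists (mklin r_lin) => v; apply: jinj; rewrite mklinE rP.
have -> : g (j v) = 0 by apply: gU; exists v.
by rewrite (linear0 b) subr0.
Qed.

(** Take [U] to be the kernel of [q]: the component of a preimage along the complement is still a
    preimage and does not depend on the one chosen. *)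
Lemma linear_section (k : fieldType) (V W : lmodType k)
    (q : {linear V -> W}) : (forall w, exists v, q v = w) ->
  exists s : {linear W -> V}, cancel s q.
Proof.
move=> qsurj; have Usub : subspace (fun v => q v = 0).
  by split=> [|c u v qu qv]; rewrite ?raddf0 // linearP qu qv scaler0 addr0.
have [I [b [g [bg gU Ub]]]] := basis_mod Usub.
pose s w := b (g (sval (cid (qsurj w)))).
have sP w v : q v = w -> s w = b (g v).
  rewrite /s; case: cid => /= v' qv' qv; congr (b _); apply/eqP.
  rewrite -subr_eq0 -(linearB g); apply/eqP/gU.
  by rewrite (linearB q) qv' qv subrr.
have qs w : q (s w) = w.
  rewrite /s; case: cid => v /= <-; apply/eqP; rewrite eq_sym -subr_eq0 -(linearB q).
  by rewrite Ub.
have s_lin : linear s.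
  move=> c u v; have [u' qu] := qsurj u; have [v' qv] := qsurj v.
  rewrite (sP u u') // (sP v v') // (sP _ (c *: u' + v')).
    by rewrite (linearP g) (linearP b).
  by rewrite (linearP q) qu qv.
by exists (mklin s_lin).
Qed.

(** * Finite dimension and finite index sets *)

Section FiniteDimension.
Variables (k : fieldType).

Definition free_in (I : Type) (i : I) : free_space k I :=
  @dsum_in k I (fun=> k^o) i 1.

Lemma free_inE (I : Type) (i j : I) :
  dval (free_in i) j = (`[< i = j >])%:R.
Proof.
rewrite dsum_inE; case: asboolP => [<-|ij]; first by rewrite dsum_in_same.
by rewrite dsum_in_diff.
Qed.

Lemma freeZ (I : Type) c (F : free_space k I) i : dval (c *: F) i = c * dval F i.
Proof. by []. Qed.

Lemma freeD (I : Type) (F F' : free_space k I) i :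
  dval (F + F') i = dval F i + dval F' i.
Proof. by []. Qed.

Lemma dval_sum (I J : Type) (s : seq J) (F : J -> free_space k I) i :
  dval (\sum_(j <- s) F j) i = \sum_(j <- s) dval (F j) i.
Proof.
exact: (big_morph (fun F : free_space k I => dval F i) (fun F F' => dsumD F F' i) (dsum0 _ i)).
Qed.

Lemma free_space_seq_bound n (I : Type) (h : {linear free_space k I -> 'rV[k]_n})
    (s : seq {classic I}) : injective h -> uniq s -> (size s <= n)%N.
Proof.
move=> hinj us; rewrite leqNgt; apply/negP => ns.
pose e (i : 'I_(size s)) : I := tnth (in_tuple s) i.
have e_inj i j : e i = e j -> i = j by exact: (tuple_uniqP (in_tuple s) us).
pose A := \matrix_i h (free_in (e i)).
have : kermx A != 0.
  by rewrite kermx_eq0 /row_free neq_ltn (leq_ltn_trans (rank_leq_col A)).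
case/rowV0Pn=> u /sub_kermxP uA /eqP; apply.
pose S : free_space k I := \sum_j u 0 j *: free_in (e j).
have S0 : S = 0.
  apply: hinj; rewrite linear0 linear_sum -[RHS]uA mulmx_sum_row.
  by apply: eq_bigr => j _; rewrite linearZ rowK.
apply/rowP => j; rewrite mxE -(dsum0 (fun=> k^o : lmodType k) (e j)) -S0.
rewrite /S dval_sum (bigD1 j) // freeZ free_inE asboolT // mulr1 big1 => [|l lj].
  exact/esym/addr0.
rewrite freeZ free_inE asboolF ?mulr0 // => /e_inj lj'.
by rewrite lj' eqxx in lj.
Qed.

Lemma free_space_finite n (I : Type) (h : {linear free_space k I -> 'rV[k]_n}) :
  injective h -> exists m (s : 'I_m -> I), bijective s.
Proof.
move=> hinj.
have [s [us sI]] : exists s : seq {classic I}, uniq s /\ forall i, i \in s.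
  apply: contrapT => Ns.
  (* If no duplicate-free list exhausts [I], lists can be extended indefinitely, beyond the bound
     [n]. *)
  suff [s [us sz]] : exists s : seq {classic I}, uniq s /\ size s = n.+1.
    by have := free_space_seq_bound hinj us; rewrite sz ltnn.
  elim: n.+1 => [|m [s [us sz]]]; first by exists [::].
  have [i iNs] : exists i, i \notin s.
    apply: contrapT => sI; apply: Ns; exists s; split=> // i.
    by apply: contrapT => iNs; apply: sI; exists i; apply/negP.
  by exists (i :: s); rewrite /= iNs us sz.
exists (size s), (tnth (in_tuple s)).
have idx (i : I) : (index (i : {classic I}) s < size s)%N by rewrite index_mem sI.
exists (fun i => Ordinal (idx i)) => [i|i].
  apply/val_inj => /=; rewrite (tnth_nth (tnth (in_tuple s) i)) /=.
  exact: index_uniq.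
by rewrite (tnth_nth (i : {classic I})) /= nth_index.
Qed.

(** [finite_dimensional] asks for a bijection, while modules of functions on G come with an
    injection into row vectors. *)
Lemma finite_basis n (V : lmodType k) (h : {linear V -> 'rV[k]_n}) :
  injective h -> exists m (f : {linear V -> 'rV[k]_m}), bijective f.
Proof.
move=> hinj; have U0 : subspace (fun v : V => v = 0).
  by split=> // c u v -> ->; rewrite scaler0 addr0.
have [I [b [g [bg _ Ub]]]] := basis_mod U0.
have gb : cancel g b by move=> v; have /eqP := Ub v; rewrite subr_eq0 => /eqP.
have [|m [s [s' sK s'K]]] := @free_space_finite n I (h \o b).
  by move=> x y /= /hinj /(can_inj bg).
pose f v : 'rV[k]_m := \row_j dval (g v) (s j).
have f_lin : linear f.
  by move=> c u v; apply/rowP => j; rewrite !mxE (linearP g) freeD freeZ.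
exists m, (mklin f_lin).
exists (fun r : 'rV[k]_m => b (\sum_j r 0 j *: free_in (s j))) => [v|r]; rewrite mklinE.
  rewrite -[RHS]gb; congr (b _); apply: dsum_ext => i; rewrite dval_sum.
  rewrite (bigD1 (s' i)) // big1 => [|j ji].
    by rewrite freeZ free_inE asboolT // mxE s'K mulr1; exact: addr0.
  rewrite freeZ free_inE asboolF ?mulr0 // => ij.
  by rewrite -ij sK eqxx in ji.
apply/rowP => j; rewrite mxE bg dval_sum (bigD1 j) // big1 => [|l lj].
  by rewrite freeZ free_inE asboolT // mulr1; exact: addr0.
rewrite freeZ free_inE asboolF ?mulr0 // => /(can_inj sK) lj'.
by rewrite lj' eqxx in lj.
Qed.

End FiniteDimension.

(** * Modules over the group algebra *)

Section Coinduced.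
Variables (k : fieldType) (gT : finGroupType).
Local Notation kG := (group_algebra k gT).

Definition gel (g : gT) : kG := [ffun u : gT => (u == g)%:R].
Definition coef (a : kG) (g : gT) : k := (a : {ffun gT -> k}) g.

Lemma galg_ext (a b : kG) : (forall g, coef a g = coef b g) -> a = b.
Proof. by move=> ab; apply/ffunP. Qed.

Lemma coefM (a b : kG) g :
  coef (a * b) g = \sum_(h : gT) coef a h * coef b (h^-1 * g)%g.
Proof. exact: ffunE. Qed.
Lemma coefD (a b : kG) g : coef (a + b) g = coef a g + coef b g.
Proof. exact: ffunE. Qed.
Lemma coefN (a : kG) g : coef (- a) g = - coef a g.
Proof. exact: ffunE. Qed.
Lemma coefZ c (a : kG) g : coef (c *: a) g = c * coef a g.
Proof. exact: ffunE. Qed.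
Lemma coef0 g : coef 0 g = 0. Proof. exact: ffunE. Qed.
Lemma coef1 g : coef 1 g = (g == 1%g)%:R. Proof. exact: ffunE. Qed.
Lemma coef_gel g u : coef (gel g) u = (u == g)%:R. Proof. exact: ffunE. Qed.
Lemma coef_sum (J : Type) (s : seq J) (Q : pred J) (F : J -> kG) g :
  coef (\sum_(j <- s | Q j) F j) g = \sum_(j <- s | Q j) coef (F j) g.
Proof. exact: (big_morph (coef^~ g) (fun a b => coefD a b g) (coef0 g)). Qed.

Lemma coef_gelM g (a : kG) u : coef (gel g * a) u = coef a (g^-1 * u)%g.
Proof.
rewrite coefM (bigD1 g) //= big1 => [|h hg].
  by rewrite coef_gel eqxx mul1r addr0.
by rewrite coef_gel (negPf hg) mul0r.
Qed.

Lemma gel1 : gel 1%g = 1.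
Proof. by apply: galg_ext => u; rewrite coef_gel. Qed.

Lemma gelM g h : gel (g * h)%g = gel g * gel h.
Proof.
by apply: galg_ext => u; rewrite coef_gelM !coef_gel -[in RHS](inj_eq (mulgI g)) mulKVg.
Qed.

Lemma galg_decomp (a : kG) : a = \sum_(g : gT) coef a g *: gel g.
Proof.
apply: galg_ext => u; rewrite coef_sum (bigD1 u) //= big1 => [|h hu].
  by rewrite coefZ coef_gel eqxx mulr1 addr0.
by rewrite coefZ coef_gel eq_sym (negPf hu) mulr0.
Qed.

Definition act (M : lmodType kG) (g : gT) (m : M) : M := gel g *: m.

(** Stated on the kG-modules themselves, so that k-linear and kG-linear maps compose freely; it is
    convertible to linearity between the [restrict_scalars]. *)
Definition klin (M N : lmodType kG) (f : M -> N) := forall (c : k) x y,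
  f ((c%:A : kG) *: x + y) = (c%:A : kG) *: f x + f y.

Section Act.
Variables (M : lmodType kG).
Implicit Types (x y : M).

Lemma act1 x : act 1%g x = x. Proof. by rewrite /act gel1 scale1r. Qed.
Lemma actM g h x : act (g * h)%g x = act g (act h x).
Proof. by rewrite /act gelM scalerA. Qed.
Lemma actD g x y : act g (x + y) = act g x + act g y.
Proof. exact: scalerDr. Qed.
Lemma act0 g : act g (0 : M) = 0. Proof. exact: scaler0. Qed.
Lemma actN g x : act g (- x) = - act g x. Proof. exact: scalerN. Qed.
Lemma actB g x y : act g (x - y) = act g x - act g y.
Proof. exact: scalerBr. Qed.
Lemma act_sum g (J : Type) (s : seq J) (Q : pred J) (F : J -> M) :
  act g (\sum_(j <- s | Q j) F j) = \sum_(j <- s | Q j) act g (F j).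
Proof. exact: scaler_sumr. Qed.

Lemma scale_decomp (a : kG) x :
  a *: x = \sum_(g : gT) ((coef a g)%:A : kG) *: act g x.
Proof.
rewrite {1}[a]galg_decomp scaler_suml; apply: eq_bigr => g _.
by rewrite /act scalerA -scalerAl mul1r.
Qed.

Lemma scalar_comm (a : kG) (c : k) x :
  a *: ((c%:A : kG) *: x) = (c%:A : kG) *: (a *: x).
Proof. by rewrite !scalerA -scalerAr -scalerAl mulr1 mul1r. Qed.

Lemma klin_scale (a : kG) : klin (fun x : M => a *: x).
Proof. by move=> c x y; rewrite scalerDr scalar_comm. Qed.
Lemma klin_act g : klin (@act M g). Proof. exact: klin_scale. Qed.
End Act.

Section Klin.
Variables (M N : lmodType kG) (f : M -> N).
Hypothesis fk : klin f.

Lemma klinD x y : f (x + y) = f x + f y.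
Proof. by have := fk 1 x y; rewrite !scale1r. Qed.
Lemma klin0 : f 0 = 0.
Proof. by apply: (addrI (f 0)); rewrite -klinD !addr0. Qed.
Lemma klinZ (c : k) x : f ((c%:A : kG) *: x) = (c%:A : kG) *: f x.
Proof. by have := fk c x 0; rewrite klin0 !addr0. Qed.
Lemma klinN x : f (- x) = - f x.
Proof. by apply: (addrI (f x)); rewrite -klinD !subrr klin0. Qed.
Lemma klinB x y : f (x - y) = f x - f y. Proof. by rewrite klinD klinN. Qed.
Lemma klin_sumE (J : Type) (s : seq J) (Q : pred J) (F : J -> M) :
  f (\sum_(j <- s | Q j) F j) = \sum_(j <- s | Q j) f (F j).
Proof. exact: (big_morph f klinD klin0). Qed.

Lemma klin_linear :
  linear (f : restrict_scalars M -> restrict_scalars N).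
Proof. exact: fk. Qed.

Lemma linear_klin : (forall g x, f (act g x) = act g (f x)) -> linear f.
Proof.
move=> fact a x y; rewrite klinD; congr (_ + _).
rewrite !scale_decomp klin_sumE; apply: eq_bigr => g _.
by rewrite klinZ fact.
Qed.
End Klin.

Lemma klin_lin (M N : lmodType kG) (f : {linear M -> N}) : klin f.
Proof. by move=> c x y; rewrite linearP. Qed.

Lemma lin_act (M N : lmodType kG) (f : {linear M -> N}) g x :
  f (act g x) = act g (f x).
Proof. exact: linearZ_LR. Qed.

Lemma klin_comp (M N L : lmodType kG) (f : N -> L) (h : M -> N) :
  klin f -> klin h -> klin (fun x => f (h x)).
Proof. by move=> fk hk c x y; rewrite hk fk. Qed.

Lemma klin_add (M N : lmodType kG) (f h : M -> N) :
  klin f -> klin h -> klin (fun x => f x + h x).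
Proof. by move=> fk hk c x y; rewrite hk fk scalerDr addrACA. Qed.

Lemma klin_opp (M N : lmodType kG) (f : M -> N) :
  klin f -> klin (fun x => - f x).
Proof. by move=> fk c x y; rewrite fk opprD scalerN. Qed.

Lemma klin_retraction (M N : lmodType kG) (j : {linear M -> N}) :
  injective j -> exists r : N -> M, klin r /\ cancel j r.
Proof.
move=> jinj; have [r jr] := @linear_retraction k (restrict_scalars M)
  (restrict_scalars N) (mklin (klin_linear (klin_lin j))) jinj.
by exists r; split=> // c x y; exact: (linearP r).
Qed.

Lemma klin_section (M N : lmodType kG) (q : {linear M -> N}) :
  (forall y, exists x, q x = y) -> exists s : N -> M, klin s /\ cancel s q.
Proof.
move=> qsurj; have [s sq] := @linear_section k (restrict_scalars M)
  (restrict_scalars N) (mklin (klin_linear (klin_lin q))) qsurj.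
by exists s; split=> // c x y; exact: (linearP s).
Qed.

(* [coinduced V] is the free module [kG (x) V], an element being the family
   of its components. *)
Definition coinduced (V : lmodType k) : Type := {ffun gT -> V}.

Section CoinducedModule.
Variable V : lmodType k.
Local Notation kGV := (coinduced V).

HB.instance Definition _ := GRing.Zmodule.on kGV.

Definition comp (F : kGV) (g : gT) : V := (F : {ffun gT -> V}) g.
Definition coind_mk (F : gT -> V) : kGV := [ffun g => F g].

Lemma coind_ext (F F' : kGV) : (forall g, comp F g = comp F' g) -> F = F'.
Proof. by move=> FF'; apply/ffunP. Qed.
Lemma comp_mk F g : comp (coind_mk F) g = F g. Proof. exact: ffunE. Qed.
Lemma compD F F' g : comp (F + F') g = comp F g + comp F' g.
Proof. exact: ffunE. Qed.

Definition coind_scale (a : kG) (F : kGV) : kGV :=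
  coind_mk (fun g => \sum_(h : gT) coef a h *: comp F (h^-1 * g)%g).

Lemma coind_scaleA a b F : coind_scale a (coind_scale b F) = coind_scale (a * b) F.
Proof.
apply: coind_ext => g; rewrite !comp_mk.
under eq_bigr do rewrite comp_mk scaler_sumr.
under [RHS]eq_bigr do rewrite coefM scaler_suml.
rewrite [RHS]exchange_big /=; apply: eq_bigr => h _.
rewrite [RHS](reindex_inj (mulgI h)) /=; apply: eq_bigr => u _.
by rewrite scalerA mulKg invMg mulgA.
Qed.

Lemma coind_scale1 : left_id 1 coind_scale.
Proof.
move=> F; apply: coind_ext => g; rewrite comp_mk (bigD1 1%g) //= big1 => [|h h1].
  by rewrite coef1 eqxx scale1r invg1 mul1g addr0.
by rewrite coef1 (negPf h1) scale0r.
Qed.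

Lemma coind_scaleDr : right_distributive coind_scale +%R.
Proof.
move=> a F F'; apply: coind_ext => g; rewrite compD !comp_mk -big_split /=.
by apply: eq_bigr => h _; rewrite compD scalerDr.
Qed.

Lemma coind_scaleDl F : {morph coind_scale^~ F : a b / a + b}.
Proof.
move=> a b; apply: coind_ext => g; rewrite compD !comp_mk -big_split /=.
by apply: eq_bigr => h _; rewrite coefD scalerDl.
Qed.

HB.instance Definition _ := GRing.Zmodule_isLmodule.Build kG kGV
  coind_scaleA coind_scale1 coind_scaleDr coind_scaleDl.

Lemma comp_act g (F : kGV) u : comp (act g F) u = comp F (g^-1 * u)%g.
Proof.
rewrite /act comp_mk (bigD1 g) //= big1 => [|h hg].
  by rewrite coef_gel eqxx scale1r addr0.
by rewrite coef_gel (negPf hg) scale0r.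
Qed.

Lemma compZ (c : k) (F : kGV) u : comp ((c%:A : kG) *: F) u = c *: comp F u.
Proof.
rewrite comp_mk (bigD1 1%g) //= big1 => [|h hg].
  by rewrite coefZ coef1 eqxx mulr1 invg1 mul1g addr0.
by rewrite coefZ coef1 (negPf hg) mulr0 scale0r.
Qed.

Definition coind_in (v : V) : kGV := coind_mk (fun g => if g == 1%g then v else 0).

Lemma coind_decomp (F : kGV) : F = \sum_(g : gT) act g (coind_in (comp F g)).
Proof.
apply: coind_ext => u.
rewrite (big_morph (comp^~ u) (fun a b => compD a b u) (ffunE _ u)).
rewrite (bigD1 u) //= big1 => [|h hu]; rewrite comp_act comp_mk.
  by rewrite mulVg eqxx addr0.
by rewrite -eq_mulVg1 (negPf hu).
Qed.

Section Extend.
Variables (A : lmodType kG) (f : {linear V -> restrict_scalars A}).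

Definition coind_ext_fun (F : kGV) : A := \sum_(g : gT) act g (f (comp F g) : A).

Lemma coind_ext_linear : linear coind_ext_fun.
Proof.
apply: linear_klin => [c F F'|u F]; rewrite /coind_ext_fun.
  rewrite scaler_sumr -big_split; apply: eq_bigr => g _ /=.
  by rewrite compD compZ linearP actD -[X in act g X]/((c%:A : kG) *: _) /act scalar_comm.
rewrite act_sum (reindex_inj (mulgI u)); apply: eq_bigr => g _ /=.
by rewrite comp_act mulKg actM.
Qed.
End Extend.

(** A map out of kG (x) V is determined by its k-linear restriction to the component at 1, and that
    restriction lifts because surjections split over k. *)
Lemma coind_projective : projective (coinduced V).
Proof.
move=> M N q f qsurj; have [s [sk sq]] := klin_section qsurj.
pose h0 (v : V) : restrict_scalars M := s (f (coind_in v)).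
have h0_lin : linear h0.
  move=> c v w; rewrite /h0.
  have -> : coind_in (c *: v + w) = (c%:A : kG) *: coind_in v + coind_in w.
    apply: coind_ext => g; rewrite compD compZ !comp_mk.
    by case: ifP; rewrite // scaler0 addr0.
  by rewrite linearP sk.
exists (mklin (coind_ext_linear (mklin h0_lin))) => F.
rewrite mklinE /coind_ext_fun linear_sum [F in RHS]coind_decomp linear_sum.
by apply: eq_bigr => g _; rewrite !lin_act mklinE /h0 sq.
Qed.

End CoinducedModule.
End Coinduced.

(** * Traces and stable triviality *)

Section Traces.
Variables (k : fieldType) (gT : finGroupType).
Local Notation kG := (group_algebra k gT).
Implicit Types (M N L P K : lmodType kG) (H : {group gT}).

(** The transfer of a k-linear map. With [A] the whole group, Higman's criterion characterizes the
    kG-maps that factor through a projective as the traces. *)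
Definition trace (A : {set gT}) M N (chi : M -> N) (x : M) : N :=
  \sum_(u in A) act u (chi (act u^-1%g x)).

Definition is_trace (A : {set gT}) M N (f : M -> N) :=
  exists chi : M -> N, klin chi /\ forall x, f x = trace A chi x.

(** Linearity over kH for maps between kG-modules, so that restriction to a subgroup never needs a
    second group algebra. *)
Definition hlin (A : {set gT}) M N (f : M -> N) :=
  klin f /\ forall u x, u \in A -> f (act u x) = act u (f x).

Lemma lin_hlin A M N (f : {linear M -> N}) : hlin A f.
Proof. by split; [exact: klin_lin|move=> u x _; exact: lin_act]. Qed.

Lemma trace_klin A M N (chi : M -> N) : klin chi -> klin (trace A chi).
Proof.
move=> chik c x y; rewrite /trace scaler_sumr -big_split; apply: eq_bigr => u _ /=.
by rewrite (klin_act u^-1%g) chik (klin_act u).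
Qed.

Lemma trace_hlin H M N (chi : M -> N) : klin chi -> hlin H (trace H chi).
Proof.
move=> chik; split=> [|u x Hu]; first exact: trace_klin.
rewrite /trace act_sum (reindex_inj (mulgI u)) /=.
apply: eq_big => [v|v _]; first by rewrite groupMl.
by rewrite invMg -actM mulgKV actM.
Qed.

Lemma is_traceD A M N (f h : M -> N) :
  is_trace A f -> is_trace A h -> is_trace A (fun x => f x + h x).
Proof.
move=> [chi [chik fE]] [psi [psik hE]]; exists (fun x => chi x + psi x).
split=> [|x]; first exact: klin_add.
by rewrite fE hE /trace -big_split; apply: eq_bigr => u _; rewrite actD.
Qed.

Lemma is_traceN A M N (f : M -> N) : is_trace A f -> is_trace A (fun x => - f x).
Proof.
move=> [chi [chik fE]]; exists (fun x => - chi x).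
split=> [|x]; first exact: klin_opp.
by rewrite fE /trace -sumrN; apply: eq_bigr => u _; rewrite actN.
Qed.

Lemma is_trace0 A M N : is_trace A (fun _ : M => 0 : N).
Proof.
exists (fun=> 0); split=> [c x y|x]; first by rewrite scaler0 addr0.
by rewrite /trace big1 // => u _; exact: act0.
Qed.

Lemma eq_is_trace A M N (f h : M -> N) :
  (forall x, f x = h x) -> is_trace A h -> is_trace A f.
Proof. by move=> fh [chi [chik hE]]; exists chi; split=> // x; rewrite fh. Qed.

Lemma is_trace_compl H M N L (a : N -> L) (f : M -> N) :
  hlin H a -> is_trace H f -> is_trace H (fun x => a (f x)).
Proof.
move=> [ak aH] [chi [chik fE]]; exists (fun x => a (chi x)).
split=> [|x]; first exact: klin_comp.
by rewrite fE /trace (klin_sumE ak); apply: eq_bigr => u Hu; rewrite aH.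
Qed.

Lemma is_trace_compr H M N L (f : N -> L) (a : M -> N) :
  hlin H a -> is_trace H f -> is_trace H (fun x => f (a x)).
Proof.
move=> [ak aH] [chi [chik fE]]; exists (fun x => chi (a x)).
split=> [|x]; first exact: klin_comp.
by rewrite fE /trace; apply: eq_bigr => u Hu; rewrite aH ?groupV.
Qed.

Lemma sum_rcosets H (V : zmodType) (F : gT -> V) :
  \sum_(g : gT) F g =
  \sum_(A in rcosets H [set: gT]) \sum_(u in H) F (u * repr A)%g.
Proof.
rewrite (eq_bigl (mem [set: gT])) => [|g]; last by rewrite /= inE.
rewrite (set_partition_big _ (rcosets_partition (finset.subsetT H))) /=.
apply: eq_bigr => A /rcosetsP[x _ ->].
move Ey: (repr (H :* x)%g) => y.
have <- : (H :* y = H :* x)%g by rewrite -Ey rcoset_repr.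
rewrite [LHS](reindex_inj (mulIg y)) /=.
by apply: eq_bigl => u; rewrite mem_rcoset mulgK.
Qed.

(** Transitivity of the transfer: the conjugates of [chi] by representatives of the right cosets of
    H are summed first. *)
Lemma is_trace_sub H M N (f : M -> N) : is_trace [set: gT] f -> is_trace H f.
Proof.
move=> [chi [chik fE]].
exists (fun x => \sum_(A in rcosets H [set: gT])
  act (repr A) (chi (act (repr A)^-1%g x))); split=> [c x y|x].
  rewrite scaler_sumr -big_split; apply: eq_bigr => A _ /=.
  by rewrite (klin_act (repr A)^-1%g) chik (klin_act (repr A)).
rewrite fE /trace (eq_bigl predT) => [|g]; last by rewrite inE.
rewrite (sum_rcosets H) exchange_big; apply: eq_bigr => u _ /=.
by rewrite act_sum; apply: eq_bigr => A _; rewrite invMg !actM.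
Qed.

(** On kG (x) P the identity is the trace of the projection to the component at 1. A splitting [s]
    of kG (x) P -> P carries this over to [P]. *)
Lemma projective_trace P : projective P -> is_trace [set: gT] (@id P).
Proof.
move=> Pproj.
pose q : {linear coinduced gT (restrict_scalars P) -> P} :=
  mklin (coind_ext_linear (idfun : {linear restrict_scalars P -> restrict_scalars P})).
have qE F : q F = \sum_(g : gT) act g (comp F g : P) by [].
have qsurj x : exists F, q F = x.
  exists (coind_in gT (x : restrict_scalars P)); rewrite qE (bigD1 1%g) //= big1.
    by rewrite comp_mk eqxx act1 addr0.
  by move=> g g1; rewrite comp_mk (negPf g1) act0.
have [s sq] := Pproj _ _ q idfun qsurj.
exists (fun x => comp (s x) 1%g : P); split=> [c x y|x].
  by rewrite linearP compD compZ.
transitivity (q (s x)); first by rewrite sq.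
rewrite qE /trace [RHS](eq_bigl predT) => [|g]; last by rewrite inE.
by apply: eq_bigr => g _; rewrite lin_act comp_act invgK mulg1.
Qed.

Section Objects.
Variable obj : lmodType kG -> Prop.

Lemma stably_trivial_trace M N (f : {linear M -> N}) :
  stably_trivial obj f -> is_trace [set: gT] f.
Proof.
move=> [P [_ Pproj [a [b fE]]]]; apply: (eq_is_trace fE).
apply: (@is_trace_compl [set: gT]%G _ _ _ b); first exact: lin_hlin.
apply: (@is_trace_compr [set: gT]%G _ _ _ id a); first exact: lin_hlin.
exact: projective_trace.
Qed.

Hypothesis obj_coind : forall N, obj N -> obj (coinduced gT (restrict_scalars N)).

(** A trace factors through kG (x) N by sending [x] to the family of the chi (g^-1 x); [obj_coind]
    keeps this projective in the category. *)
Lemma trace_stably_trivial M N (f : {linear M -> N}) :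
  obj N -> is_trace [set: gT] f -> stably_trivial obj f.
Proof.
move=> objN [chi [chik fE]]; exists (coinduced gT (restrict_scalars N)).
split; [exact: obj_coind|exact: coind_projective|].
pose a (x : M) : coinduced gT (restrict_scalars N) :=
  coind_mk (V := restrict_scalars N) (fun g => chi (act g^-1%g x)).
have a_lin : linear a.
  apply: linear_klin => [c x y|u x]; apply: coind_ext => g.
    by rewrite compD compZ !comp_mk (klin_act g^-1%g) chik.
  by rewrite comp_act !comp_mk invMg invgK actM.
exists (mklin a_lin), (mklin (coind_ext_linear
  (idfun : {linear restrict_scalars N -> restrict_scalars N}))) => x.
rewrite fE !mklinE /coind_ext_fun /trace (eq_bigl predT) => [|g]; last by rewrite inE.
by apply: eq_bigr => g _; rewrite comp_mk.
Qed.

End Objects.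

(* How a central element of a subgroup acts on the suspensions of [k]:
   multiplication by [z = h^-1 - 1] is stably zero on their restrictions to
   [H], because it is zero on [k] and Omega is functorial. *)
Section CentralElement.
Variables (H : {group gT}) (h : gT).
Hypothesis hH : forall u, u \in H -> commute u h.

(** The inverse is there because h^-1 acts on a function by F |-> F (h _): at the point 1, [zel]
    takes F to F h - F 1, as does [affine_shift] below. *)
Definition zel : kG := gel k h^-1%g - 1.

Lemma zel_hlin M : hlin H (fun x : M => zel *: x).
Proof.
split=> [|u x Hu]; first exact: klin_scale.
rewrite /act !scalerA /zel mulrBl mulrBr mul1r mulr1 -!gelM.
by rewrite (commuteV (hH Hu)).
Qed.

Lemma zel_lin M N (f : {linear M -> N}) x : f (zel *: x) = zel *: f x.
Proof. exact: linearZ_LR. Qed.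

Definition zel_trace M := is_trace H (fun x : M => zel *: x).

Lemma zel_trace_triv : zel_trace (trivial_module k gT).
Proof.
apply: eq_is_trace (is_trace0 _ _ _) => x.
rewrite /zel scalerBl scale1r; apply/eqP; rewrite subr_eq0; apply/eqP.
have -> : gel k h^-1%g *: x = augmentation (gel k h^-1%g) * x :> k by [].
rewrite /augmentation (bigD1 h^-1%g) //= big1 => [|g gh].
  by rewrite ffunE eqxx addr0 mul1r.
by rewrite ffunE (negPf gh).
Qed.

Lemma zel_trace_iso obj M N :
  stably_isomorphic obj M N -> zel_trace M -> zel_trace N.
Proof.
move=> [f [g [_ fg]]] zM; have tfg := is_trace_sub H (stably_trivial_trace fg).
apply: (@eq_is_trace _ _ _ _ (fun x => f (zel *: g x) - zel *: (f (g x) - x))).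
  by move=> x; rewrite zel_lin -scalerBr subKr.
apply: is_traceD.
  apply: (@is_trace_compl H _ _ _ f _ (lin_hlin H f)).
  exact: (@is_trace_compr H _ _ _ _ g (lin_hlin H g) zM).
apply: is_traceN; apply: (@is_trace_compl H _ _ _ (fun x : N => zel *: x)) tfg.
exact: zel_hlin.
Qed.

Section Omega.
Variables (obj : lmodType kG -> Prop) (M K P : lmodType kG).
Variables (j : {linear K -> P}) (q : {linear P -> M}).
Hypotheses (Pproj : projective P) (jinj : injective j).
Hypothesis qsurj : forall y, exists x, q x = y.
Hypothesis exact_jq : forall x, q x = 0 <-> exists z, j z = x.

Let qj x : q (j x) = 0. Proof. by apply/exact_jq; exists x. Qed.

Lemma hlinB A M1 N1 (f g : M1 -> N1) :
  hlin A f -> hlin A g -> hlin A (fun x => f x - g x).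
Proof.
move=> [fk fA] [gk gA]; split=> [|u x Au]; first exact/klin_add/klin_opp.
by rewrite fA // gA // actB.
Qed.

(** Lift the trace on [M] to the trace of s psi q on [P]. The difference [D] between [zel] and this
    lift is H-linear with q D = 0, so it maps into [K]; on [K] it equals [zel], since q j = 0. So
    [zel] on [K] factors through [P], whose identity is a trace. *)
Lemma zel_trace_Omega : zel_trace M -> zel_trace K.
Proof.
move=> [psi [psik psiE]]; have [s [sk sq]] := klin_section qsurj.
have chik : klin (fun x : P => s (psi (q x))).
  exact: (klin_comp sk (klin_comp psik (klin_lin q))).
pose D x := zel *: x - trace H (fun x : P => s (psi (q x))) x.
have [Dk DH] : hlin H D := hlinB (zel_hlin P) (trace_hlin H chik).
have /choice[d dE] x : exists y, j y = D x.
  apply/exact_jq; rewrite /D linearB zel_lin psiE /trace linear_sum.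
  apply/eqP; rewrite subr_eq0; apply/eqP/eq_bigr => u _.
  by rewrite !lin_act sq.
apply: (@eq_is_trace _ _ _ _ (fun y => d (j y))).
  move=> y; apply: jinj; rewrite dE /D zel_lin /trace big1 ?subr0 // => u _.
  by rewrite lin_act qj act0 (klin0 psik) (klin0 sk) act0.
have dH : hlin H d.
  split=> [c x y|u x Hu]; apply: jinj; first by rewrite dE Dk linearP !dE.
  by rewrite dE DH // lin_act dE.
apply: (@is_trace_compl H _ _ _ d j dH).
apply: (@is_trace_compr H _ _ _ (@id P) j); first exact: lin_hlin.
exact/is_trace_sub/projective_trace.
Qed.

(** The dual argument: [zel] minus the trace of j psi r vanishes on [K], hence factors through [q],
    and it induces [zel] on [M]. *)
Lemma zel_trace_Omega_inv : zel_trace K -> zel_trace M.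
Proof.
move=> [psi [psik psiE]]; have [s [sk sq]] := klin_section qsurj.
have [r [rk jr]] := klin_retraction jinj.
have chik : klin (fun x : P => j (psi (r x))).
  exact: (klin_comp (klin_lin j) (klin_comp psik rk)).
pose D x := zel *: x - trace H (fun x : P => j (psi (r x))) x.
have [Dk DH] : hlin H D := hlinB (zel_hlin P) (trace_hlin H chik).
have Dj y : D (j y) = 0.
  apply/eqP; rewrite /D -zel_lin psiE /trace linear_sum subr_eq0; apply/eqP.
  by apply: eq_bigr => u _; rewrite -!lin_act jr.
pose d y := D (s y).
have dq x : d (q x) = D x.
  have [y jy] : exists y, j y = s (q x) - x.
    by apply/exact_jq; rewrite linearB sq subrr.
  by apply/eqP; rewrite -subr_eq0 -(klinB Dk) -jy Dj.
have dH : hlin H d.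
  split=> [c x y|u x Hu]; first by rewrite /d sk Dk.
  have [{}x <-] := qsurj x.
  by rewrite -lin_act !dq DH.
apply: (@eq_is_trace _ _ _ _ (fun y => q (d y))).
  move=> y; have [{}y <-] := qsurj y; rewrite dq /D linearB zel_lin.
  rewrite /trace linear_sum big1 ?subr0 // => u _.
  by rewrite lin_act qj act0.
apply: (@is_trace_compl H _ _ _ q d (lin_hlin H q)).
apply: (@is_trace_compr H _ _ _ (@id P) d dH).
exact/is_trace_sub/projective_trace.
Qed.

End Omega.

Lemma zel_trace_iter obj n M X :
  is_Omega_iter_nat obj n M X -> zel_trace M <-> zel_trace X.
Proof.
elim: n M => [|n IHn] M /=.
  move=> MX; split; first exact: zel_trace_iso MX.
  by case: MX => f [g [gf fg]]; apply: (@zel_trace_iso obj); exists g, f.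
move=> [Y [[P [_ _ Pproj [j [q [jinj qsurj jq]]]]] YX]].
rewrite -(IHn _ YX); split; first exact: zel_trace_Omega jq.
exact: zel_trace_Omega_inv jq.
Qed.

Lemma suspension_zel_trace obj i X : suspension_of_k obj i X -> zel_trace X.
Proof.
move=> [_]; have zk := zel_trace_triv.
by case: i => n /zel_trace_iter[MX XM]; [exact: MX|exact: XM].
Qed.

End CentralElement.
End Traces.

(** * A ghost that is not stably trivial *)

Lemma coef_smul (k : fieldType) (gT : finGroupType) (c : k)
    (a : group_algebra k gT) g : coef ((c%:A : group_algebra k gT) * a) g = c * coef a g.
Proof. by rewrite -scalerAl mul1r coefZ. Qed.

Section StModObjects.
Variables (k : fieldType) (gT : finGroupType).
Local Notation kG := (group_algebra k gT).

Lemma finite_dimensional_inj n (M : lmodType kG) (f : M -> 'rV[k]_n) :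
  (forall c x y, f ((c%:A : kG) *: x + y) = c *: f x + f y) -> injective f ->
  finite_dimensional M.
Proof.
move=> f_lin finj.
have f_lin' : linear (f : restrict_scalars M -> 'rV[k]_n) by exact: f_lin.
exact: (@finite_basis k n _ (mklin f_lin')).
Qed.

Lemma finite_dimensional_coind (M : lmodType kG) :
  finite_dimensional M -> finite_dimensional (coinduced gT (restrict_scalars M)).
Proof.
move=> [n [f [f' fK _]]].
pose F (x : coinduced gT (restrict_scalars M)) : 'rV[k]_(#|gT| * n) :=
  mxvec (\matrix_(i, j) f (comp x (enum_val i)) 0 j).
apply: (@finite_dimensional_inj _ _ F) => [c x y|x y].
  rewrite /F -linearP; congr mxvec; apply/matrixP => i j.
  by rewrite !mxE compD compZ linearP !mxE.
move=> /(can_inj mxvecK) /matrixP E; apply: coind_ext => g.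
apply: (can_inj fK); apply/rowP => j.
by have := E (enum_rank g) j; rewrite !mxE enum_rankK.
Qed.

End StModObjects.

Section AffineModule.
Variables (k : fieldType) (gT : finGroupType) (H : {group gT}) (h : gT).
Variable lam : gT -> k.
Local Notation kG := (group_algebra k gT).

(** Since lam h = 1, the factor of lam u is the slope of [a] on the coset g H. The condition only
    involves right translations, so left multiplication by kG preserves it. *)
Definition affine_on_cosets : {pred kG^o} := fun a : kG =>
  [forall g, forall (u | u \in H),
    coef a (g * u)%g - coef a g == lam u * (coef a (g * h)%g - coef a g)].

Lemma affineP (a : kG) : reflect
  (forall g u, u \in H ->
    coef a (g * u)%g - coef a g = lam u * (coef a (g * h)%g - coef a g))
  ((a : kG^o) \in affine_on_cosets).
Proof.
apply: (iffP forallP) => [E g u Hu|E g].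
  by apply/eqP; move: (E g) => /forall_inP/(_ u Hu).
by apply/forall_inP => u Hu; apply/eqP/E.
Qed.

Lemma affine_submod : submod_closed affine_on_cosets.
Proof.
split=> [|a x y /affineP xa /affineP ya]; apply/affineP => g u Hu.
  by rewrite !coef0 !subrr mulr0.
have -> : a *: x + y = a * (x : kG) + y :> kG by [].
pose S v w := \sum_(g : gT) coef a g * (coef x (g^-1 * v)%g - coef x (g^-1 * w)%g).
have SE v w : coef (a * (x : kG)) v - coef (a * (x : kG)) w = S v w.
  by rewrite !coefM -sumrB; apply: eq_bigr => g' _; rewrite mulrBr.
have E v w : coef (a * (x : kG) + y) v - coef (a * (x : kG) + y) w =
  S v w + (coef y v - coef y w).
  by rewrite !coefD opprD [LHS]addrACA SE.
suff ES : S (g * u)%g g = lam u * S (g * h)%g g by rewrite !E ya // ES -mulrDr.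
rewrite /S mulr_sumr; apply: eq_bigr => g' _.
by rewrite !mulgA xa // mulrCA.
Qed.

HB.instance Definition _ :=
  GRing.isSubmodClosed.Build kG kG^o affine_on_cosets affine_submod.

Record affine := Affine {
  affine_val : kG^o;
  affine_in : affine_val \in affine_on_cosets
}.

HB.instance Definition _ := [isSub for affine_val].
HB.instance Definition _ := [Choice of affine by <:].
HB.instance Definition _ := [SubChoice_isSubLmodule of affine by <:].

Definition acoef (F : affine) (g : gT) : k := coef (affine_val F) g.

Lemma acoef_ext F F' : (forall g, acoef F g = acoef F' g) -> F = F'.
Proof. by move=> E; apply/val_inj/galg_ext. Qed.
Lemma acoefD F F' g : acoef (F + F') g = acoef F g + acoef F' g.
Proof. exact: coefD. Qed.
Lemma acoef0 g : acoef 0 g = 0. Proof. exact: coef0. Qed.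
Lemma acoefZ (c : k) F g : acoef ((c%:A : kG) *: F) g = c * acoef F g.
Proof. exact: coef_smul. Qed.
Lemma acoefN F g : acoef (- F) g = - acoef F g.
Proof. exact: coefN. Qed.
Lemma acoef_act u F g : acoef (act u F) g = acoef F (u^-1 * g)%g.
Proof. exact: coef_gelM. Qed.
Lemma acoef_sum (J : Type) (s : seq J) (Q : pred J) (F : J -> affine) g :
  acoef (\sum_(j <- s | Q j) F j) g = \sum_(j <- s | Q j) acoef (F j) g.
Proof.
exact: (big_morph (acoef^~ g) (fun a b => acoefD a b g) (acoef0 g)).
Qed.
Lemma acoef_affine F g u : u \in H ->
  acoef F (g * u)%g = acoef F g + lam u * (acoef F (g * h)%g - acoef F g).
Proof.
by move=> Hu; have /affineP <- := affine_in F; rewrite // addrC subrK.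
Qed.

Lemma affine_fd : finite_dimensional affine.
Proof.
apply: (@finite_dimensional_inj _ _ _ _ (fun F => \row_i acoef F (enum_val i))).
  by move=> c x y; apply/rowP => i; rewrite !mxE acoefD acoefZ.
move=> x y /rowP E; apply: acoef_ext => g.
by have := E (enum_rank g); rewrite !mxE enum_rankK.
Qed.

Hypotheses (Hh : h \in H) (hH : forall u, u \in H -> commute u h).
Hypothesis lamM : forall u v, u \in H -> v \in H -> lam (u * v)%g = lam u + lam v.
Hypothesis lamh : lam h = 1.

Lemma lam1 : lam 1%g = 0.
Proof. by apply: (addrI (lam 1%g)); rewrite -lamM // mulg1 addr0. Qed.

Lemma lamV u : u \in H -> lam u^-1%g = - lam u.
Proof.
move=> Hu; apply: (addrI (lam u)); rewrite -lamM ?groupV //.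
by rewrite mulgV lam1 subrr.
Qed.

Lemma affine_mk (a : gT -> k) :
  (forall g u, u \in H -> a (g * u)%g - a g = lam u * (a (g * h)%g - a g)) ->
  exists F : affine, forall g, acoef F g = a g.
Proof.
move=> aE; pose a' : kG := [ffun g => a g].
have a'E g : coef a' g = a g by exact: ffunE.
have a'_in : (a' : kG^o) \in affine_on_cosets.
  by apply/affineP => g u Hu; rewrite !a'E aE.
by exists (Affine a'_in).
Qed.

(** Both sides are zero: the shifted function is the slope of [F], which is constant on cosets. *)
Lemma affine_shift_in (F : affine) g u : u \in H ->
  (acoef F (g * u * h)%g - acoef F (g * u)%g) - (acoef F (g * h)%g - acoef F g)
  = lam u * ((acoef F (g * h * h)%g - acoef F (g * h)%g)
             - (acoef F (g * h)%g - acoef F g)).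
Proof.
move=> Hu; rewrite -!(mulgA g) [acoef F (g * (u * h))%g]acoef_affine ?groupM //.
rewrite [acoef F (g * (h * h))%g]acoef_affine ?groupM //.
rewrite [acoef F (g * u)%g]acoef_affine // !lamM // lamh.
ring.
Qed.

Definition affine_shift (F : affine) : affine :=
  sval (cid (affine_mk (affine_shift_in F))).

Lemma acoef_shift F g :
  acoef (affine_shift F) g = acoef F (g * h)%g - acoef F g.
Proof. by rewrite /affine_shift; case: cid. Qed.

Lemma affine_shift_linear : linear affine_shift.
Proof.
apply: linear_klin => [c x y|u x]; apply: acoef_ext => g.
  by rewrite acoefD acoefZ !acoef_shift !acoefD !acoefZ mulrBr opprD addrACA.
by rewrite acoef_act !acoef_shift !acoef_act mulgA.
Qed.

(* This is right multiplication by [h^-1 - 1]. *)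
Definition affine_ghost : {linear affine -> affine} := mklin affine_shift_linear.

(** A coset g H lies in H or is disjoint from it, so extending by zero off H preserves the
    condition. This is the projection of the induced module to its component at the trivial
    coset. *)
Lemma affine_cut_in (F : affine) g u : u \in H ->
  let a v := if v \in H then acoef F v else 0 in
  a (g * u)%g - a g = lam u * (a (g * h)%g - a g).
Proof.
move=> Hu /=; rewrite !groupMr //; case: ifP => _; last by rewrite subrr mulr0.
by rewrite [acoef F (g * u)%g]acoef_affine // addrC addKr.
Qed.

Definition affine_cut (F : affine) : affine :=
  sval (cid (affine_mk (affine_cut_in F))).

Lemma acoef_cut F g : acoef (affine_cut F) g = if g \in H then acoef F g else 0.
Proof. by rewrite /affine_cut; case: cid. Qed.

Lemma affine_cut_klin : klin affine_cut.
Proof.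
move=> c x y; apply: acoef_ext => g; rewrite acoefD acoefZ !acoef_cut.
by case: ifP => _; rewrite ?mulr0 ?addr0 // acoefD acoefZ.
Qed.

Section GhostProperty.
Variable obj : lmodType kG -> Prop.
Hypothesis obj_coind : forall N, obj N -> obj (coinduced gT (restrict_scalars N)).
Hypothesis obj_affine : obj affine.

(** Frobenius reciprocity made explicit: a map into [affine] is known from its values at 1. There
    the shift agrees with [zel], which passes through [f] to the suspension X and is the trace over
    H of some [psi]. Cutting f psi to H turns this into a trace over G. *)
Lemma affine_ghostP : ghost obj affine_ghost.
Proof.
move=> i X Xsusp f; apply: trace_stably_trivial => //.
have [psi [psik psiE]] := suspension_zel_trace hH Xsusp.
exists (fun x => affine_cut (f (psi x))); split.
  exact: (klin_comp affine_cut_klin (klin_comp (klin_lin f) psik)).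
move=> x; apply: acoef_ext => v.
transitivity (acoef (f (trace H psi (act v^-1%g x))) 1%g).
  rewrite -psiE zel_lin lin_act /zel scalerBl scale1r acoefD acoefN.
  rewrite -/(act _ _) !acoef_act !invgK !mulg1 acoef_shift.
  by [].
rewrite /trace linear_sum !acoef_sum /=.
(* In the trace over G evaluated at [v], the cut keeps the group elements v u with u^-1 in H, which
   is the range of the trace over H. *)
rewrite [RHS](reindex_inj (mulgI v)) /= big_mkcond [RHS]big_mkcond /=.
apply: eq_bigr => u _; rewrite inE acoef_act acoef_cut lin_act acoef_act mulg1.
by rewrite invMg mulgKV groupV actM.
Qed.

Hypothesis sum_lam0 : #|H|%:R = 0 :> k.
Hypothesis sum_lam1 : \sum_(u in H) lam u = 0.
Hypothesis sum_lam2 : \sum_(u in H) lam u ^+ 2 = 0.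

(** The test vector [w] is lam on H and 0 elsewhere: its slope on H is 1, and H moves it only by
    multiples of the indicator function [o] of H. *)
Lemma affine_ghost_nontrivial : ~ stably_trivial obj affine_ghost.
Proof.
move=> /stably_trivial_trace [chi [chik chiE]].
have [w wE] : exists w : affine, forall g, acoef w g = if g \in H then lam g else 0.
  apply: affine_mk => g u Hu; rewrite !groupMr //.
  case: ifP => Hg; last by rewrite subrr mulr0.
  by rewrite !lamM // lamh addrC addKr addrC addKr mulr1.
have [o oE] : exists o : affine, forall g, acoef o g = if g \in H then 1 else 0.
  by apply: affine_mk => g u Hu; rewrite !groupMr // subrr mulr0.
have act_w u : u \in H -> act u^-1%g w = ((lam u)%:A : kG) *: o + w.
  move=> Hu; apply: acoef_ext => g.
  rewrite acoef_act acoefD acoefZ !wE oE invgK groupMl //.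
  by case: ifP => Hg; rewrite ?lamM // ?mulr1 // mulr0 addr0.
have : acoef (affine_ghost w) 1%g = 1.
  by rewrite [LHS]acoef_shift mul1g !wE Hh group1 lamh lam1 subr0.
rewrite chiE acoef_sum (eq_bigl predT) => [|g]; last by rewrite inE.
rewrite (sum_rcosets H) big1 => [/esym/eqP|A _]; first by rewrite oner_eq0.
set t := repr A; set a := chi (act t^-1%g w); set b := chi (act t^-1%g o).
(* One factor lam u comes from u^-1 w = lam u o + w, another from evaluating an affine function at
   t^-1 u^-1; hence a quadratic polynomial in lam u. *)
transitivity (\sum_(u in H) (acoef a t^-1%g
  + lam u * (acoef b t^-1%g - (acoef a (t^-1 * h)%g - acoef a t^-1%g))
  - lam u ^+ 2 * (acoef b (t^-1 * h)%g - acoef b t^-1%g))).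
  apply: eq_bigr => u Hu; rewrite acoef_act mulg1 invMg actM act_w //.
  rewrite (klin_act t^-1%g) chik acoefD acoefZ !(acoef_affine _ t^-1%g (groupVr Hu)).
  by rewrite lamV // -/a -/b; ring.
rewrite sumrB big_split /= -!mulr_suml sum_lam1 sum_lam2 !mul0r subr0 addr0.
by rewrite sumr_const -mulr_natr sum_lam0 mulr0.
Qed.

Lemma affine_ghosts : ~ no_nontrivial_ghosts obj.
Proof.
move=> /(_ _ _ obj_affine obj_affine affine_ghost affine_ghostP).
exact: affine_ghost_nontrivial.
Qed.

End GhostProperty.
End AffineModule.

(** * Additive characters of p-groups and their power sums *)

Section AdditiveCharacters.
Variables (k : fieldType) (gT : finGroupType) (p : nat).
Hypotheses (p_pr : prime p) (kp : p \in [pchar k]).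

Lemma natr_modp m n : m = n %[mod p] -> m%:R = n%:R :> k.
Proof.
move=> mn; rewrite (divn_eq m p) (divn_eq n p) mn !natrD !natrM.
by rewrite (pcharf0 kp) !mulr0.
Qed.

Lemma additive_character (H K : {group gT}) : (K <| H)%g -> #|H : K|%g = p ->
  exists h (lam : gT -> k), [/\ h \in H, lam h = 1,
    forall u v, u \in H -> v \in H -> lam (u * v)%g = lam u + lam v &
    forall c, c \in K -> lam c = 0].
Proof.
move=> nKH ipHK; have nH u : u \in H -> u \in ('N(K))%g.
  by exact: (fintype.subsetP (normal_norm nKH)).
have cardHK : #|H / K|%g = p by rewrite card_quotient // normal_norm.
have [h Hh hK] : exists2 h, h \in H & h \notin K.
  apply/fintype.subsetPn; rewrite -indexg_eq1 ipHK.
  by rewrite gtn_eqF ?prime_gt1.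
pose x := coset K h; have xHK : x \in (H / K)%g by exact: mem_quotient.
have ox : #[x]%g = p.
  have : (#[x]%g %| p)%N by rewrite -cardHK order_dvdG.
  have /primeP[_ pmin] := p_pr; move=> /pmin /orP[|/eqP//].
  by rewrite order_eq1 => /eqP/coset_idr hK'; rewrite hK' ?nH in hK.
have HKE : (H / K = <[x]>)%g.
  by apply/eqP; rewrite eq_sym eqEcard cycle_subG xHK -orderE ox cardHK leqnn.
(* The discrete logarithm of the coset of [u] to the base [x], read in k; the default 0 is reached
   only off H. *)
pose lam u : k :=
  if [pick i : 'I_p | coset K u == (x ^+ i)%g] is Some i then i%:R else 0.
have lamE u i : coset K u = (x ^+ i)%g -> lam u = i%:R.
  move=> ui; rewrite /lam; case: pickP => [j /eqP uj|/(_ (Ordinal (ltn_pmod i (prime_gt0 p_pr))))].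
    apply: natr_modp; apply/eqP; move: uj; rewrite ui => /eqP.
    by rewrite eq_expg_mod_order ox eq_sym.
  by rewrite /= -ox expg_mod_order ui eqxx.
have lam_ex u : u \in H -> exists i, coset K u = (x ^+ i)%g.
  by move=> Hu; apply/cycleP; rewrite -HKE mem_quotient.
exists h, lam; split=> //.
- by rewrite (lamE h 1%N).
- move=> u v Hu Hv; have [i ui] := lam_ex u Hu; have [j vj] := lam_ex v Hv.
  rewrite (lamE u i) // (lamE v j) // (lamE _ (i + j)%N) ?natrD //.
  by rewrite morphM ?nH //= ui vj expgD.
- by move=> c Kc; rewrite (lamE c 0%N) // coset_id.
Qed.

(** [F] is constant on each right coset of K in H, and such a coset has #|K| elements, a number that
    is zero in k. *)
Lemma sum_character_coset (H K : {group gT}) (F : gT -> k) :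
  K \subset H -> #|K|%:R = 0 :> k ->
  (forall c u, c \in K -> u \in H -> F (c * u)%g = F u) ->
  \sum_(u in H) F u = 0.
Proof.
move=> sKH K0 FK; rewrite big_mkcond (sum_rcosets K) big1 // => A _.
set t := repr A; have [Ht|Ht] := boolP (t \in H).
  under eq_bigr => u Ku do rewrite groupMr // (fintype.subsetP sKH _ Ku) FK //.
  by rewrite sumr_const -mulr_natr K0 mulr0.
rewrite big1 // => u Ku.
by rewrite groupMl ?(negPf Ht) //; exact: (fintype.subsetP sKH u Ku).
Qed.

End AdditiveCharacters.

Lemma character_data (k : fieldType) (gT : finGroupType) (p : nat) :
  prime p -> (p.-group [set: gT])%g -> ([set: gT] != 1)%g -> p \in [pchar k] ->
  ~ (([set: gT] \isog Zp 2)%g \/ ([set: gT] \isog Zp 3)%g) ->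
  exists (H : {group gT}) h (lam : gT -> k),
    [/\ h \in H, forall u, u \in H -> commute u h,
        forall u v, u \in H -> v \in H -> lam (u * v)%g = lam u + lam v &
        lam h = 1] /\
    [/\ #|H|%:R = 0 :> k, \sum_(u in H) lam u = 0 &
        \sum_(u in H) lam u ^+ 2 = 0].
Proof.
move=> p_pr pG G1 kp notC23.
have [n cG] := p_natP pG.
have n0 : (0 < n)%N.
  by case: n cG => // /eqP; rewrite expn0 -trivg_card1 (negPf G1).
have [n1|n2] := leqP n 1.
  have {n n0 n1} cG : #|[set: gT]| = p.
    by move: cG; case: n n0 n1 => // -[|//] _ _ ->; rewrite expn1.
  have cycG : cyclic [set: gT]%g by apply: prime_cyclic; rewrite cG.
  have isoC (q : nat) : prime q -> p = q -> ([set: gT] \isog Zp q)%g.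
    move=> q_pr pq; have cZ : #|Zp_group q| = q := card_Zp (prime_gt0 q_pr).
    rewrite (@isog_cyclic_card _ _ _ (Zp_group q)) // cZ [_ == _](_ : _ = true).
      by rewrite andbT; apply: prime_cyclic; rewrite cZ.
    by apply/eqP; rewrite -pq -cG.
  have p5 : (4 < p)%N.
    rewrite ltnNge; apply/negP => p4.
    have /orP[/eqP p2|/eqP p3] : (p == 2) || (p == 3).
    - by move: p_pr p4; clear; case: p => [|[|[|[|[|q]]]]].
    - by apply: notC23; left; exact: isoC.
    - by apply: notC23; right; exact: isoC.
  have [|h [lam [Hh lamh lamM lamK]]] := @additive_character k gT p p_pr kp [set: gT]%G 1%G (normal1 _).
    by rewrite indexg1 cG.
  have nat0 m : (0 < m < p)%N -> m%:R != 0 :> k.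
    move=> /andP[m0 mp]; rewrite -(dvdn_pcharf kp).
    by apply/negP => /(dvdn_leq m0); rewrite leqNgt mp.
  (* Squaring permutes a group of odd order and doubles lam, so the sums of lam and lam^2 are
     multiplied by 2 and 4 without changing. They vanish because 1 and 3 are nonzero in k, as p >
     3. *)
  have sq_inj : injective (fun u : gT => u ^+ 2)%g.
    have cop : coprime #|[set: gT]| 2.
      rewrite cG prime_coprime // dvdn_prime2 //.
      by apply/eqP => p2; rewrite p2 in p5.
    by move=> u v uv; apply: (can_in_inj (expgK cop)) uv; rewrite inE.
  have lam2 u : lam (u ^+ 2)%g = 2%:R * lam u.
    by rewrite expgS expg1 lamM ?inE // mulr_natl mulr2n.
  exists [set: gT]%G, h, lam; split; first split=> //.
    move=> u Gu; have /centsP := cyclic_abelian cycG.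
    by apply; rewrite ?inE.
  split; first by rewrite cG (pcharf0 kp).
    have E : \sum_(u in [set: gT]) lam u = 2%:R * \sum_(u in [set: gT]) lam u.
      rewrite {1}(reindex_inj sq_inj) mulr_sumr.
      by apply: eq_big => [u|u _]; rewrite ?inE ?lam2.
    move: E => /eqP; rewrite -subr_eq0 -{1}[X in X - _]mul1r -mulrBl mulf_eq0.
    case/orP => [|/eqP//]; rewrite -opprB oppr_eq0.
    by rewrite [_ - _](_ : _ = 1%:R) ?(negPf (nat0 1%N _)) ?prime_gt1 //; ring.
  have E : \sum_(u in [set: gT]) lam u ^+ 2 =
           4%:R * \sum_(u in [set: gT]) lam u ^+ 2.
    rewrite {1}(reindex_inj sq_inj) mulr_sumr.
    by apply: eq_big => [u|u _]; rewrite ?inE ?lam2 //; ring.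
  move: E => /eqP; rewrite -subr_eq0 -{1}[X in X - _]mul1r -mulrBl mulf_eq0.
  case/orP => [|/eqP//]; rewrite -opprB oppr_eq0.
  rewrite [_ - _](_ : _ = 3%:R) ?(negPf (nat0 3%N _)) //; last by ring.
  by rewrite (leq_trans _ p5).
(* A subgroup of order p^2 is abelian, so any of its elements may serve as [h]; lam is chosen
   trivial on a subgroup K of order p, and all sums vanish coset by coset. *)
have [|H [sHG _ cH]] := normal_pgroup pG (normal_refl _) (_ : 2 <= _)%N.
  by rewrite cG pfactorK.
have pH : (p.-group H)%g by exact: pgroupS sHG pG.
have [|K [sKH nKH cK]] := normal_pgroup pH (normal_refl _) (_ : 1 <= _)%N.
  by rewrite cH pfactorK.
have abH : abelian H by exact: (card_p2group_abelian p_pr cH).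
have [|h [lam [Hh lamh lamM lamK]]] := @additive_character k gT p p_pr kp H K nKH.
  by rewrite -divgS // cH cK expn1 expnS mulKn ?prime_gt0.
have K0 : #|K|%:R = 0 :> k by rewrite cK expn1 (pcharf0 kp).
have lamc c u : c \in K -> u \in H -> lam (c * u)%g = lam u.
  by move=> Kc Hu; rewrite (lamM _ _ (fintype.subsetP sKH c Kc) Hu) lamK // add0r.
exists H, h, lam; split; split=> //.
- by move=> u Hu; exact: (centsP abH).
- by rewrite cH natrX (pcharf0 kp) expr0n.
- exact: (sum_character_coset sKH K0).
- by apply: (sum_character_coset sKH K0) => c u Kc Hu; rewrite lamc.
Qed.

Lemma no_ghosts_C2_C3 (k : fieldType) (gT : finGroupType) (p : nat)
    (obj : lmodType (group_algebra k gT) -> Prop) :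
  prime p -> (p.-group [set: gT])%g -> ([set: gT] != 1)%g -> p \in [pchar k] ->
  (forall N, obj N -> obj (coinduced gT (restrict_scalars N))) ->
  (forall N, finite_dimensional N -> obj N) ->
  no_nontrivial_ghosts obj ->
  ([set: gT] \isog Zp 2)%g \/ ([set: gT] \isog Zp 3)%g.
Proof.
move=> p_pr pG G1 kp obj_coind obj_fd noghost; apply: contrapT => notC23.
have [H [h [lam [[Hh hH lamM lamh] [H0 S1 S2]]]]] :=
  character_data p_pr pG G1 kp notC23.
have objA : obj (affine H h lam) by apply: obj_fd; exact: affine_fd.
exact: (affine_ghosts Hh hH lamM lamh obj_coind objA H0 S1 S2 noghost).
Qed.

(** * Coproducts of suspensions have no ghosts *)

Section CoproductsOfSuspensions.
Variables (k : fieldType) (gT : finGroupType).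
Local Notation kG := (group_algebra k gT).
Variable obj : lmodType kG -> Prop.

(** The k-linear maps [chi i] glue to one map on the direct sum, so no projective has to be
    assembled from those of the summands. *)
Lemma dsum_trace (I : Type) (X : I -> lmodType kG) (N : lmodType kG)
    (f : {linear direct_sum X -> N}) :
  (forall i, is_trace [set: gT] (fun x : X i => f (dsum_in x))) ->
  is_trace [set: gT] f.
Proof.
move=> ftr; pose chi i : X i -> N := sval (cid (ftr i)).
have [chik chiE] : (forall i, klin (chi i)) /\
    (forall i x, f (dsum_in x) = trace [set: gT] (chi i) x).
  by split=> i; rewrite /chi; case: cid => c [].
have chiD i x y : chi i (x + y) = chi i x + chi i y by exact: klinD.
have Lk : klin (dsum_lift chi).
  move=> c x y; rewrite dsum_liftD //; congr (_ + _).
  apply: (@dsum_lift_comm _ _ _ _ chi c%:A (fun v => (c%:A : kG) *: v)) => // [u v|i u].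
    exact: scalerDr.
  exact: klinZ.
exists (dsum_lift chi); split=> //.
have tk : klin (trace [set: gT] (dsum_lift chi)) by exact: trace_klin.
apply: dsum_ind => [|F F' HF HF'|i x]; first by rewrite linear0 (klin0 tk).
  by rewrite linearD HF HF' (klinD tk).
rewrite chiE /trace; apply: eq_bigr => u _; congr (act u _).
have -> : act u^-1%g (dsum_in x) = dsum_in (act u^-1%g x).
  exact/esym/(lin_act (mklin (@dsum_in_linear _ _ X i))).
by rewrite dsum_lift_in.
Qed.

Hypothesis obj_coind : forall N, obj N -> obj (coinduced gT (restrict_scalars N)).

(** With f and g inverse stable isomorphisms, phi = phi g f - phi (g f - id). The first term is a
    trace since a ghost kills each summand, the second because g f - id is stably trivial. *)
Lemma coproducts_no_ghosts :
  (forall M, obj M -> exists I : Type, coproduct_of_suspensions obj I M) ->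
  no_nontrivial_ghosts obj.
Proof.
move=> coprod M N objM objN phi phi_ghost.
have [I [X [Xsusp [f [g [gf _]]]]]] := coprod M objM.
apply: trace_stably_trivial => //.
have tg : is_trace [set: gT] (phi \o g).
  apply: dsum_trace => i; have [n Xn] := Xsusp i.
  exact: (stably_trivial_trace (phi_ghost n _ Xn (g \o mklin (@dsum_in_linear _ _ X i)))).
apply: (@eq_is_trace _ _ _ _ _ _ (fun x => phi (g (f x)) - phi (g (f x) - x))).
  by move=> x; rewrite -linearB subKr.
apply: is_traceD.
  exact: (@is_trace_compr _ _ [set: gT]%G _ _ _ (phi \o g) f (lin_hlin _ f) tg).
apply: is_traceN; have := stably_trivial_trace gf.
exact: (@is_trace_compl _ _ [set: gT]%G _ _ _ phi _ (lin_hlin _ phi)).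
Qed.

End CoproductsOfSuspensions.

(** * Modules over groups of order 2 and 3 *)

Section NilpotentOperator.
Variables (k : fieldType) (V : lmodType k) (x : {linear V -> V}).

Definition jordan_sum (It Iy Iz : Type) (bt : {linear free_space k It -> V})
    (by_ : {linear free_space k Iy -> V}) (bz : {linear free_space k Iz -> V})
    a0 a1 a2 b0 b1 c : V :=
  bt a0 + x (bt a1) + x (x (bt a2)) + (by_ b0 + x (by_ b1)) + bz c.

(* The Jordan blocks of sizes 3, 2 and 1 are generated, respectively, by a
   basis modulo [ker x^2], by a basis of [ker x^2] modulo [ker x + im x], and
   by a basis of [ker x] modulo [im x]. *)
Lemma jordan_decomposition : (forall v, x (x (x v)) = 0) ->
  exists (It Iy Iz : Type) (bt : {linear free_space k It -> V})
    (by_ : {linear free_space k Iy -> V}) (bz : {linear free_space k Iz -> V}),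
  [/\ forall d, x (x (by_ d)) = 0, forall d, x (bz d) = 0,
      forall m, exists a0 a1 a2 b0 b1 c,
        m = jordan_sum bt by_ bz a0 a1 a2 b0 b1 c &
      forall a0 a1 a2 b0 b1 c,
        jordan_sum bt by_ bz a0 a1 a2 b0 b1 c = 0 ->
        [/\ a0 = 0, a1 = 0, a2 = 0, b0 = 0 & b1 = 0 /\ c = 0]].
Proof.
move=> x3.
have U1sub : subspace (fun v => x (x v) = 0).
  by split=> [|c u v xu xv]; rewrite ?(linear0 x) // !(linearP x) xu xv scaler0 addr0.
have [It [bt [gt [gbt gtU Ut]]]] := basis_mod U1sub.
(* This is the image of [bt] plus ker x + im x. Including the image of [bt] lets [basis_mod] be
   applied to all of V; the quotient is ker x^2 modulo ker x + im x. [U3] is built in the same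
   way. *)
pose U2 v := exists w, x (v - bt (gt v)) = x (x w).
have U2sub : subspace U2.
  split; first by exists 0; rewrite (linear0 gt) (linear0 bt) subrr !(linear0 x).
  move=> c u v [wu uE] [wv vE]; exists (c *: wu + wv).
  rewrite !(linearP x) -uE -vE -(linearP x) (linearP gt) (linearP bt); congr (x _).
  by rewrite scalerBr opprD addrACA.
have [Iy [by0 [gy [gby gyU Uy]]]] := basis_mod U2sub.
have gtx v : gt (x v) = 0 by exact/gtU/x3.
have gyt d : gy (bt d) = 0.
  by apply: gyU; exists 0; rewrite gbt subrr !(linear0 x).
have gyx v : gy (x v) = 0.
  by apply: gyU; exists v; rewrite gtx (linear0 bt) subr0.
have gyker v : x v = 0 -> gy v = 0.
  move=> xv; apply: gyU; exists 0.
  have -> : gt v = 0 by apply: gtU; rewrite xv (linear0 x).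
  by rewrite (linear0 bt) subr0 xv !(linear0 x).
pose yf d := by0 d - bt (gt (by0 d)).
have yf_lin : linear yf.
  move=> c u v; rewrite /yf (linearP by0) (linearP gt) (linearP bt).
  by rewrite scalerBr opprD addrACA.
have [by_ byE] : exists b : {linear free_space k Iy -> V},
    forall d, b d = by0 d - bt (gt (by0 d)) by exists (mklin yf_lin).
have gty d : gt (by_ d) = 0 by rewrite byE (linearB gt) gbt subrr.
have gyy d : gy (by_ d) = d by rewrite byE (linearB gy) gyt subr0 gby.
have xxy d : x (x (by_ d)) = 0 by rewrite byE Ut.
have U2y v : U2 (v - by_ (gy v)).
  rewrite byE opprB addrCA; apply: (subspaceD U2sub); last exact: Uy.
  by exists 0; rewrite gbt subrr !(linear0 x).
pose U3 v := exists w, v - bt (gt v) - by_ (gy v) = x w.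
have U3sub : subspace U3.
  split.
    exists 0; rewrite (linear0 x) (linear0 gt) (linear0 gy) (linear0 bt).
    by rewrite (linear0 by_) !subr0.
  move=> c u v [wu uE] [wv vE]; exists (c *: wu + wv).
  rewrite (linearP x) -uE -vE (linearP gt) (linearP bt) (linearP gy) (linearP by_).
  by rewrite !scalerBr !opprD [RHS]addrACA; congr (_ + _); rewrite [RHS]addrACA.
have [Iz [bz0 [gz [gbz gzU Uz]]]] := basis_mod U3sub.
have gzt d : gz (bt d) = 0.
  by apply: gzU; exists 0; rewrite gbt gyt (linear0 x) (linear0 by_) subr0 subrr.
have gzy d : gz (by_ d) = 0.
  by apply: gzU; exists 0; rewrite gty gyy (linear0 x) (linear0 bt) subr0 subrr.
have gzx v : gz (x v) = 0.
  by apply: gzU; exists v; rewrite gtx gyx (linear0 bt) (linear0 by_) !subr0.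
(* The lifts [zm d] lie only in ker x + im x. Since x (zm d) is x^2 of an element of the image of
   [bt], a retraction [th] of x^2 bt gives a correction in im x that depends linearly on d. *)
have xxt_inj : injective (x \o x \o bt).
  move=> d d' /= E; apply/eqP; rewrite -subr_eq0 -(gbt (d - d')).
  by apply/eqP/gtU; rewrite (linearB bt) !(linearB x) E subrr.
have [th thK] := linear_retraction xxt_inj.
pose zm d := bz0 d - bt (gt (bz0 d)) - by_ (gy (bz0 d)).
have thz d : x (x (bt (th (x (zm d))))) = x (zm d).
  have [w] := U2y (bz0 d); rewrite (linearB gt) gty subr0 addrAC -/(zm d) => ->.
  have -> : x (x w) = (x \o x \o bt) (gt w).
    by apply/eqP; rewrite /= -subr_eq0 -!(linearB x) Ut.
  by rewrite thK.
pose zf d := zm d - x (bt (th (x (zm d)))).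
have zf_lin : linear zf.
  have zm_lin : linear zm.
    move=> c u v; rewrite /zm (linearP bz0) (linearP gt) (linearP bt) (linearP gy).
    rewrite (linearP by_) !scalerBr !opprD [RHS]addrACA; congr (_ + _).
    by rewrite [RHS]addrACA.
  move=> c u v; rewrite /zf zm_lin (linearP x) (linearP th) (linearP bt) (linearP x).
  by rewrite [in RHS]scalerBr opprD [LHS]addrACA.
have [bz bzE] : exists b : {linear free_space k Iz -> V},
    forall d, b d = zm d - x (bt (th (x (zm d)))) by exists (mklin zf_lin).
have xz d : x (bz d) = 0 by rewrite bzE (linearB x) thz subrr.
have gtz d : gt (bz d) = 0 by apply: gtU; rewrite xz (linear0 x).
have gyz d : gy (bz d) = 0 by apply: gyker.
have gzz d : gz (bz d) = d.
  by rewrite bzE /zm !(linearB gz) gzt gzy gzx !subr0 gbz.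
have step m : exists w, m = bt (gt m) + by_ (gy m) + bz (gz m) + x w.
  have [w] : U3 (m - bz (gz m)).
    have -> : m - bz (gz m) = (m - bz0 (gz m)) + (bz0 (gz m) - bz (gz m)).
      by rewrite addrA subrK.
    apply: (subspaceD U3sub); first exact: Uz.
    set d := gz m; have -> : bz0 d - bz d = bt (gt (bz0 d)) +
        (by_ (gy (bz0 d)) + x (bt (th (x (zm d))))).
      by rewrite bzE /zm -!addrA -!opprD subKr.
    apply: (subspaceD U3sub); [|apply: (subspaceD U3sub)].
    - by exists 0; rewrite gbt gyt (linear0 x) (linear0 by_) subr0 subrr.
    - by exists 0; rewrite gty gyy (linear0 x) (linear0 bt) subr0 subrr.
    - by exists (bt (th (x (zm d)))); rewrite gtx gyx (linear0 bt) (linear0 by_) !subr0.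
  rewrite (linearB gt) (linearB gy) gtz gyz !subr0 => /eqP.
  rewrite !subr_eq => /eqP E; exists w; rewrite [LHS]E [RHS]addrC !addrA.
  by congr (_ + _); rewrite addrAC.
exists It, Iy, Iz, bt, by_, bz; split=> //.
(* Two expansions suffice: the next remainder enters only through x^2 w', and there w' may be
   replaced by its component in the image of [bt]. *)
- move=> m; have [w mE] := step m; have [w' wE] := step w.
  exists (gt m), (gt w), (gt w'), (gy m), (gy w), (gz m).
  have xxw' : x (x w') = x (x (bt (gt w'))).
    by apply/eqP; rewrite -subr_eq0 -!(linearB x) Ut.
  rewrite /jordan_sum {1}mE {1}wE !(linearD x) xz addr0 xxw'.
  rewrite -!addrA; congr (_ + _); rewrite !addrA.
  by rewrite [LHS](ACl (3*5*1*4*2)).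
move=> a0 a1 a2 b0 b1 c E.
have Ea0 : a0 = 0.
  have := congr1 gt E.
  by rewrite /jordan_sum !(linearD gt) gbt !gtx gty gtz (linear0 gt) !addr0.
have Eb0 : b0 = 0.
  have := congr1 gy E.
  by rewrite /jordan_sum !(linearD gy) gyt !gyx gyy gyz (linear0 gy) !add0r !addr0.
have Ec : c = 0.
  have := congr1 gz E.
  by rewrite /jordan_sum !(linearD gz) gzt !gzx gzy gzz (linear0 gz) !add0r.
move: E; rewrite /jordan_sum Ea0 Eb0 Ec (linear0 bt) (linear0 by_) (linear0 bz).
rewrite !add0r addr0 => E.
(* The coordinate maps vanish on im x, so they no longer detect what remains. Removing one x gives
   an element of ker x, which [gt] and [gy] do kill. *)
have xv0 : x (bt a1 + x (bt a2) + by_ b1) = 0 by rewrite !(linearD x) E.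
have Ea1 : a1 = 0.
  have : gt (bt a1 + x (bt a2) + by_ b1) = 0 by apply: gtU; rewrite xv0 (linear0 x).
  by rewrite !(linearD gt) gbt gtx gty !addr0.
have Eb1 : b1 = 0.
  by have := gyker _ xv0; rewrite !(linearD gy) gyt gyx gyy !add0r.
split=> //; move: E; rewrite Ea1 Eb1 (linear0 bt) (linear0 by_) (linear0 x).
rewrite add0r addr0 => E.
by rewrite -(gbt a2); exact: gtU.
Qed.

Lemma jordan_sumP It Iy Iz (bt : {linear free_space k It -> V})
    (by_ : {linear free_space k Iy -> V}) (bz : {linear free_space k Iz -> V})
    s a0 a1 a2 b0 b1 c a0' a1' a2' b0' b1' c' :
  jordan_sum bt by_ bz (s *: a0 + a0') (s *: a1 + a1') (s *: a2 + a2')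
    (s *: b0 + b0') (s *: b1 + b1') (s *: c + c') =
  s *: jordan_sum bt by_ bz a0 a1 a2 b0 b1 c +
  jordan_sum bt by_ bz a0' a1' a2' b0' b1' c'.
Proof.
rewrite /jordan_sum !(linearP bt) !(linearP by_) (linearP bz) !(linearP x) !scalerDr.
by rewrite !addrA [LHS](ACl (1*3*5*7*9*11*2*4*6*8*10*12)).
Qed.

Lemma jordan_coordinates : (forall v, x (x (x v)) = 0) ->
  exists (It Iy Iz : Type) (bt : {linear free_space k It -> V})
    (by_ : {linear free_space k Iy -> V}) (bz : {linear free_space k Iz -> V})
    (A0 A1 A2 : {linear V -> free_space k It})
    (B0 B1 : {linear V -> free_space k Iy}) (C : {linear V -> free_space k Iz}),
  [/\ forall d, x (x (by_ d)) = 0, forall d, x (bz d) = 0,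
      forall m, m = jordan_sum bt by_ bz (A0 m) (A1 m) (A2 m) (B0 m) (B1 m) (C m) &
      forall a0 a1 a2 b0 b1 c m, m = jordan_sum bt by_ bz a0 a1 a2 b0 b1 c ->
        [/\ A0 m = a0, A1 m = a1, A2 m = a2, B0 m = b0 & B1 m = b1 /\ C m = c]].
Proof.
move=> /jordan_decomposition[It [Iy [Iz [bt [by_ [bz [xxy xz surj inj]]]]]]].
have uniq_coord a0 a1 a2 b0 b1 c a0' a1' a2' b0' b1' c' :
    jordan_sum bt by_ bz a0 a1 a2 b0 b1 c =
      jordan_sum bt by_ bz a0' a1' a2' b0' b1' c' ->
    [/\ a0 = a0', a1 = a1', a2 = a2', b0 = b0' & b1 = b1' /\ c = c'].
  move=> E.
  have [] := inj (-1 *: a0 + a0') (-1 *: a1 + a1') (-1 *: a2 + a2')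
    (-1 *: b0 + b0') (-1 *: b1 + b1') (-1 *: c + c').
    by rewrite jordan_sumP E scaleN1r addNr.
  rewrite !scaleN1r => /eqP; rewrite addrC subr_eq0 => /eqP-> /eqP.
  rewrite addrC subr_eq0 => /eqP-> /eqP; rewrite addrC subr_eq0 => /eqP-> /eqP.
  rewrite addrC subr_eq0 => /eqP-> [/eqP]; rewrite addrC subr_eq0 => /eqP-> /eqP.
  by rewrite addrC subr_eq0 => /eqP->.
have /choice[a0 /choice[a1 /choice[a2 /choice[b0 /choice[b1 /choice[c mE]]]]]] := surj.
have lin s u v :
    [/\ a0 (s *: u + v) = s *: a0 u + a0 v, a1 (s *: u + v) = s *: a1 u + a1 v,
        a2 (s *: u + v) = s *: a2 u + a2 v, b0 (s *: u + v) = s *: b0 u + b0 v &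
        b1 (s *: u + v) = s *: b1 u + b1 v /\ c (s *: u + v) = s *: c u + c v].
  by apply: uniq_coord; rewrite jordan_sumP -!mE.
have a0_lin : linear a0 by move=> s u v; case: (lin s u v).
have a1_lin : linear a1 by move=> s u v; case: (lin s u v).
have a2_lin : linear a2 by move=> s u v; case: (lin s u v).
have b0_lin : linear b0 by move=> s u v; case: (lin s u v).
have b1_lin : linear b1 by move=> s u v; case: (lin s u v) => _ _ _ _ [].
have c_lin : linear c by move=> s u v; case: (lin s u v) => _ _ _ _ [].
exists It, Iy, Iz, bt, by_, bz, (mklin a0_lin), (mklin a1_lin), (mklin a2_lin).
exists (mklin b0_lin), (mklin b1_lin), (mklin c_lin); split=> //.
by move=> *; apply: uniq_coord; rewrite -mE.
Qed.

End NilpotentOperator.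

Lemma regular_projective (R : nzRingType) : projective (R^o : lmodType R).
Proof.
move=> M N q f qsurj; have [m qm] := qsurj (f 1).
have h_lin : linear (fun a : R^o => (a : R) *: m).
  by move=> a u v; rewrite scalerDl scalerA.
exists (mklin h_lin) => a; rewrite mklinE linearZ_LR qm.
by rewrite -linearZ_LR; congr (f _); exact: mulr1.
Qed.

(** * Splitting a module into suspensions of k and a projective part *)

Section SplitSums.
Variables (k : fieldType) (gT : finGroupType).
Local Notation kG := (group_algebra k gT).

Lemma regular_fd : finite_dimensional (kG^o : lmodType kG).
Proof.
apply: (@finite_dimensional_inj _ _ _ _ (fun a : kG^o => \row_i coef a (enum_val i))).
  move=> c x y; apply/rowP => i; rewrite !mxE.
  by rewrite -(coef_smul c) -coefD.
move=> x y /rowP E; apply: galg_ext => g.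
by have := E (enum_rank g); rewrite !mxE enum_rankK.
Qed.

Lemma act_triv g (x : trivial_module k gT) : act g x = x.
Proof.
have -> : act g x = augmentation (gel k g) * x :> k by [].
rewrite /augmentation (bigD1 g) //= big1 => [|u ug].
  by rewrite ffunE eqxx addr0 mul1r.
by rewrite ffunE (negPf ug).
Qed.

Lemma scalar_triv (c : k) (x : trivial_module k gT) :
  (c%:A : kG) *: x = c * (x : k) :> k.
Proof.
have -> : (c%:A : kG) *: x = augmentation (c%:A : kG) * x :> k by [].
congr (_ * _); rewrite /augmentation (bigD1 1%g) //= big1 => [|g g1].
  by rewrite -/(coef _ _) coefZ coef1 eqxx mulr1 addr0.
by rewrite -/(coef _ _) coefZ coef1 (negPf g1) mulr0.
Qed.

Lemma triv_fd : finite_dimensional (trivial_module k gT : lmodType kG).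
Proof.
apply: (@finite_dimensional_inj _ _ 1 _ (fun a : trivial_module k gT => \row_i (a : k))).
  by move=> c x y; apply/rowP => i; rewrite !mxE -scalar_triv.
by move=> x y /rowP/(_ 0); rewrite !mxE.
Qed.

Variable obj : lmodType kG -> Prop.
Hypothesis obj_coind : forall N, obj N -> obj (coinduced gT (restrict_scalars N)).
Hypothesis obj_fd : forall N, finite_dimensional N -> obj N.

Lemma stably_trivial0 (M N : lmodType kG) (f : {linear M -> N}) :
  (forall x, f x = 0) -> stably_trivial obj f.
Proof.
move=> f0; exists kG^o; split; first exact/obj_fd/regular_fd.
  exact: regular_projective.
have z1 : linear (fun _ : M => 0 : kG^o) by move=> a u v; rewrite scaler0 addr0.
have z2 : linear (fun _ : kG^o => 0 : N) by move=> a u v; rewrite scaler0 addr0.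
by exists (mklin z1), (mklin z2).
Qed.

Lemma stably_isomorphic_refl (M : lmodType kG) : stably_isomorphic obj M M.
Proof.
by exists idfun, idfun; split; apply: stably_trivial0 => x; exact: subrr.
Qed.

Lemma triv_suspension : suspension_of_k obj 0 (trivial_module k gT).
Proof. by split; [exact/obj_fd/triv_fd|exact: stably_isomorphic_refl]. Qed.

(** The direct sum embeds with a strict retraction, and the projection to the complement is a trace.
    One composite being the identity on the nose, [trace_stably_trivial] is needed with target [M]
    only, and [obj] need not be known for the direct sum. *)
Definition split_sum (I : Type) (M : lmodType kG) :=
  exists X : I -> lmodType kG,
    (forall j, exists i : int, suspension_of_k obj i (X j)) /\
    exists (f : {linear direct_sum X -> M}) (g : {linear M -> direct_sum X}),
      cancel f g /\ is_trace [set: gT] (fun m => f (g m) - m).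

Lemma split_sum_coproduct (I : Type) (M : lmodType kG) :
  obj M -> split_sum I M -> coproduct_of_suspensions obj I M.
Proof.
move=> objM [X [Xsusp [f [g [fg tr]]]]]; exists X; split=> //.
exists g, f; split; first exact: trace_stably_trivial.
by apply: stably_trivial0 => F; rewrite /= fg subrr.
Qed.

(** Bases come with an abstract index type, whereas statement (4) asks for an ordinal. *)
Lemma split_sum_reindex (I J : Type) (s : J -> I) (M : lmodType kG) :
  bijective s -> split_sum I M -> split_sum J M.
Proof.
move=> [s' sK s'K] [X [Xsusp [f [g [fg tr]]]]].
exists (fun j => X (s j)); split=> //.
have fin (F : direct_sum X) : finite_set [set j | dval F (s j) != 0].
  apply: (@finite_preimage _ _ [set i | dval F i != 0] s).
    by move=> u v _ _; exact: (can_inj sK).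
  exact: dsum_finite_supp.
pose r F := sval (cid (dsum_mk (M := fun j => X (s j)) (fin F))).
have rE F j : dval (r F) j = dval F (s j) by rewrite /r; case: cid.
have r_lin : linear r.
  by move=> a u v; apply: dsum_ext => j; rewrite dsumD dsumZ !rE dsumD dsumZ.
have r_inj u v : r u = r v -> u = v.
  move=> ruv; apply: dsum_ext => i; rewrite -(s'K i) -!rE ruv.
  by [].
(* [X] is a dependent family, so a preimage under [r] requires a transport. It serves only to prove
   surjectivity; the inverse of [r] is then chosen. *)
pose castX i (e : s (s' i) = i) (x : X (s (s' i))) : X i :=
  eq_rect _ (fun i => X i) x i e.
have r_surj F : exists F', r F' = F.
  pose F0 i : X i := castX i (s'K i) (dval F (s' i)).
  have F0E j : F0 (s j) = dval F j.
    rewrite /F0 /castX; move: (s'K (s j)); rewrite (sK j) => e.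
    by rewrite (Prop_irrelevance e erefl).
  have F0fin : finite_set [set i | F0 i != 0].
    apply: (@sub_finite_set _ _ [set s j | j in [set j | dval F j != 0]]%classic).
      move=> i /= Fi; exists (s' i); rewrite ?s'K //=.
      by rewrite -F0E s'K.
    exact/finite_image/dsum_finite_supp.
  have [F' F'E] := dsum_mk F0fin.
  by exists F'; apply: dsum_ext => j; rewrite rE F'E F0E.
have /choice[t tK] := r_surj.
have t_lin : linear t.
  by move=> a u v; apply: r_inj; rewrite tK r_lin !tK.
have rK F : t (r F) = F by apply: r_inj; rewrite tK.
exists (f \o mklin t_lin), (mklin r_lin \o g); split.
  by move=> F; rewrite -[LHS]/(r (g (f (t F)))) fg tK.
by apply: eq_is_trace tr => m; congr (f _ - m); exact: rK.
Qed.

End SplitSums.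

(** * Modules over a group of prime order *)

Section CyclicOfPrimeOrder.
Variables (k : fieldType) (gT : finGroupType) (p : nat).
Local Notation kG := (group_algebra k gT).
Hypotheses (p_pr : prime p) (kp : p \in [pchar k]) (cG : #|[set: gT]| = p).
Variables (h : gT) (lam : gT -> k).
Hypothesis lamM0 : forall u v, u \in [set: gT]%G -> v \in [set: gT]%G ->
  lam (u * v)%g = lam u + lam v.
Hypothesis lamh : lam h = 1.

Let lamM u v : lam (u * v)%g = lam u + lam v.
Proof. by rewrite lamM0 ?inE. Qed.

Let lam1 : lam 1%g = 0.
Proof. by apply: (addrI (lam 1%g)); rewrite -lamM mulg1 addr0. Qed.

Lemma expg_prime_order : (h ^+ p = 1)%g.
Proof. by rewrite -cG expg_cardG ?inE. Qed.

Lemma expg_prime_inj : injective (fun i : 'I_p => h ^+ i)%g.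
Proof.
have oh : #[h]%g = p.
  have : (#[h]%g %| p)%N by rewrite -cG order_dvdG ?inE.
  have /primeP[_ pmin] := p_pr; move=> /pmin /orP[|/eqP//].
  rewrite order_eq1 => /eqP h1; move: lamh; rewrite h1 lam1 => /esym/eqP.
  by rewrite oner_eq0.
move=> i j /eqP; rewrite eq_expg_mod_order oh !modn_small // => /eqP ij.
exact: val_inj.
Qed.

Lemma expg_prime_bij : bijective (fun i : 'I_p => h ^+ i)%g.
Proof.
apply: inj_card_bij; first exact: expg_prime_inj.
by rewrite card_ord -cG cardsT.
Qed.

Lemma sum_cyclic (V : zmodType) (F : gT -> V) :
  \sum_(u : gT) F u = \sum_(i < p) F (h ^+ i)%g.
Proof. by rewrite (reindex _ (onW_bij _ expg_prime_bij)). Qed.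

Lemma trace_cyclic (M N : lmodType kG) (chi : M -> N) x :
  trace [set: gT] chi x =
  \sum_(i < p) act (h ^+ i)%g (chi (act (h ^+ i)^-1%g x)).
Proof.
rewrite -(sum_cyclic (fun u => act u (chi (act u^-1%g x)))) /trace.
by apply: eq_bigl => u; rewrite inE.
Qed.

Lemma cyclic_linear (M N : lmodType kG) (f : M -> N) :
  klin f -> (forall x, f (act h x) = act h (f x)) -> linear f.
Proof.
move=> fk fh; apply: linear_klin => // u x.
have [r _ rK] := expg_prime_bij; rewrite -(rK u).
elim: (nat_of_ord _) x => [|i IHi] x; first by rewrite !act1.
by rewrite expgS !actM fh IHi.
Qed.

Definition xel : kG := gel k h - 1.

Lemma xel_act (M : lmodType kG) (m : M) : act h m = m + xel *: m.
Proof. by rewrite /xel scalerBl scale1r addrC subrK. Qed.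

(** By the Frobenius in characteristic p, (h - 1)^p = h^p - 1. *)
Lemma xel_nilpotent : xel ^+ p = 0.
Proof.
have kGp : p \in [pchar kG] by rewrite pchar_lalg.
rewrite -(pFrobenius_autE kGp) pFrobenius_autB_comm; last exact: commr1.
rewrite pFrobenius_aut1 pFrobenius_autE.
suff -> : gel k h ^+ p = 1 by rewrite subrr.
rewrite -(gel1 k gT) -expg_prime_order; elim: (p) => [|n IHn].
  by rewrite expr0 expg0 gel1.
by rewrite exprS expgS gelM IHn.
Qed.

Definition xop (M : lmodType kG) :
    {linear restrict_scalars M -> restrict_scalars M} :=
  mklin (klin_linear (@klin_scale _ _ M xel)).

Lemma xopE (M : lmodType kG) (m : M) : xop M m = xel *: m. Proof. by []. Qed.

Lemma xop3 (M : lmodType kG) : (p <= 3)%N -> forall m, xop M (xop M (xop M m)) = 0.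
Proof.
move=> p3 m; rewrite !xopE !scalerA -mulrA -expr2 -exprS.
by rewrite -(subnKC p3) exprD xel_nilpotent mul0r scale0r.
Qed.

Lemma natp_scale (M : lmodType kG) (m : M) : m *+ p = 0.
Proof.
have kGp : p \in [pchar kG] by rewrite pchar_lalg.
by rewrite -[m]scale1r scalerMnl (pcharf0 kGp) scale0r.
Qed.

(** With H = G there is a single coset, so [affine] is the Jordan block of size 2. *)
Local Notation E2 := (affine [set: gT] h lam).

(* [jordan2 a b] is [a e + b (h - 1) e] for the generator [e = - lam]. *)
Lemma jordan2_mk (a b : k) : exists F : E2, forall u, acoef F u = b - lam u * a.
Proof.
apply: affine_mk => g u _; rewrite !lamM lamh; ring.
Qed.

Definition jordan2 (a b : k) : E2 := sval (cid (jordan2_mk a b)).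
Definition pr0 (F : E2) : k := acoef F 1%g - acoef F h.
Definition pr1 (F : E2) : k := acoef F 1%g.

Lemma jordan2E a b u : acoef (jordan2 a b) u = b - lam u * a.
Proof. by rewrite /jordan2; case: cid. Qed.

Lemma pr0K a b : pr0 (jordan2 a b) = a.
Proof. by rewrite /pr0 !jordan2E lam1 lamh; ring. Qed.

Lemma pr1K a b : pr1 (jordan2 a b) = b.
Proof. by rewrite /pr1 jordan2E lam1 mul0r subr0. Qed.

Lemma jordan2K F : jordan2 (pr0 F) (pr1 F) = F.
Proof.
apply: acoef_ext => u; rewrite jordan2E /pr0 /pr1.
have := acoef_affine F 1%g (finset.in_setT u); rewrite !mul1g => ->; ring.
Qed.

Lemma jordan2_act a b : act h (jordan2 a b) = jordan2 a (b + a).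
Proof.
apply: acoef_ext => u; rewrite acoef_act !jordan2E lamM.
have -> : lam h^-1%g = -1.
  by apply: (addrI (lam h)); rewrite -lamM mulgV lam1 lamh subrr.
ring.
Qed.

Lemma pr0_act F : pr0 (act h F) = pr0 F.
Proof. by rewrite -[F]jordan2K jordan2_act !pr0K. Qed.

Lemma pr1_act F : pr1 (act h F) = pr1 F + pr0 F.
Proof. by rewrite -[F]jordan2K jordan2_act !pr1K pr0K. Qed.

Lemma jordan2_lin c a b a' b' :
  jordan2 (c * a + a') (c * b + b') = (c%:A : kG) *: jordan2 a b + jordan2 a' b'.
Proof.
by apply: acoef_ext => u; rewrite acoefD acoefZ !jordan2E; ring.
Qed.

Lemma pr0_lin c F F' : pr0 ((c%:A : kG) *: F + F') = c * pr0 F + pr0 F'.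
Proof. by rewrite /pr0 !acoefD !acoefZ; ring. Qed.

Lemma pr1_lin c F F' : pr1 ((c%:A : kG) *: F + F') = c * pr1 F + pr1 F'.
Proof. by rewrite /pr1 acoefD acoefZ. Qed.

Lemma jordan2_00 : jordan2 0 0 = 0.
Proof. by apply: acoef_ext => u; rewrite jordan2E acoef0 mulr0 subr0. Qed.

Section Objects.
Variable obj : lmodType kG -> Prop.
Hypothesis obj_fd : forall N, finite_dimensional N -> obj N.

(** Because (h - 1)^2 kills e, h^i e = e + i (h - 1) e. *)
Lemma jordan2_cover (a : kG) : p = 3%N ->
  a *: jordan2 1 0 = jordan2 (coef a 1%g + coef a h + coef a (h * h)%g)
                             (coef a h + coef a (h * h)%g *+ 2).
Proof.
move=> p3; rewrite scale_decomp sum_cyclic p3 !big_ord_recl big_ord0 /= addr0.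
rewrite /bump /= expg0 expg1 expgS expg1 act1 actM !jordan2_act.
apply: acoef_ext => u; rewrite !acoefD !acoefZ !jordan2E; ring.
Qed.

(** [Negz 0] is -1, so k has to represent Omega of the block. The sequence is 0 -> k -> kG -> E2 ->
    0, with k embedded as the constant functions: in characteristic 3 the two equations of
    [jordan2_cover] force all three coefficients to be equal. *)
Lemma jordan2_suspension : p = 3%N -> suspension_of_k obj (Negz 0) E2.
Proof.
move=> p3; have k3 : 3%:R = 0 :> k by rewrite -p3 (pcharf0 kp).
split; first by apply: obj_fd; exact: affine_fd.
exists (trivial_module k gT); split; last exact: stably_isomorphic_refl.
exists kG^o; split; [exact/obj_fd/regular_fd|exact/obj_fd/triv_fd|exact: regular_projective|].
have q_lin : linear (fun a : kG^o => (a : kG) *: jordan2 1 0).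
  by move=> a u v; rewrite scalerDl scalerA.
pose jf (c : trivial_module k gT) : kG^o := [ffun=> c : k].
have jfE c u : coef (jf c) u = c by exact: ffunE.
have j_lin : linear jf.
  apply: cyclic_linear => [c x y|x]; apply: galg_ext => u.
    have -> : (c%:A : kG) *: jf x + jf y = (c%:A : kG) * (jf x : kG) + jf y :> kG by [].
    by rewrite coefD coef_smul !jfE scalar_triv.
  by rewrite act_triv jfE [RHS]coef_gelM jfE.
exists (mklin j_lin), (mklin q_lin); split.
- by move=> x y /(congr1 (fun a : kG => coef a 1%g)); rewrite !jfE.
(* From h e = e + (h - 1) e one gets a e + b (h - 1) e = (a - b) e + b h e. *)
- move=> F; exists (((pr0 F - pr1 F)%:A : kG) + (pr1 F)%:A * gel k h).
  rewrite mklinE scalerDl -scalerA -/(act h _) jordan2_act.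
  apply: etrans (jordan2K F); apply: acoef_ext => u.
  rewrite acoefD !acoefZ !jordan2E; ring.
- move=> a; rewrite mklinE jordan2_cover //; split=> [E|[z <-]].
    have Ea : coef a 1%g + coef a h + coef a (h * h)%g = 0.
      by rewrite -[LHS](pr0K _ (coef a h + coef a (h * h)%g *+ 2)) E /pr0 !acoef0 subrr.
    have Eb : coef a h + coef a (h * h)%g *+ 2 = 0.
      by rewrite -[LHS](pr1K (coef a 1%g + coef a h + coef a (h * h)%g)) E /pr1 acoef0.
    exists (coef a (h * h)%g); apply: galg_ext => u; rewrite mklinE jfE.
    have [r _ rK] := expg_prime_bij; rewrite -(rK u).
    case: (r u) => i /=; rewrite p3; case: i => [|[|[|//]]] _.
    - rewrite expg0.
      have -> : coef a 1%g = (coef a 1%g + coef a h + coef a (h * h)%g)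
        - (coef a h + coef a (h * h)%g *+ 2) + coef a (h * h)%g by ring.
      by rewrite Ea Eb subrr add0r.
    - rewrite expg1.
      have -> : coef a h = (coef a h + coef a (h * h)%g *+ 2)
        + coef a (h * h)%g - 3%:R * coef a (h * h)%g by ring.
      by rewrite Eb k3 mul0r subr0 add0r.
    - by rewrite expgS expg1.
  rewrite mklinE !jfE -jordan2_00; congr jordan2.
    by transitivity (3%:R * (z : k)); [ring|rewrite k3 mul0r].
  by transitivity (3%:R * (z : k)); [ring|rewrite k3 mul0r].
Qed.

Section Decomposition.
Variable M : lmodType kG.
Local Notation Mk := (restrict_scalars M).
Local Notation x := (xop M).

(** As h acts by 1 + x, it adds to each coordinate the preceding one in the same block. Injectivity
    of [by_] and [bz] will bound the number of blocks when [M] is finite-dimensional. *)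
Lemma jordan_module : (p <= 3)%N ->
  exists (It Iy Iz : Type) (bt : {linear free_space k It -> Mk})
    (by_ : {linear free_space k Iy -> Mk}) (bz : {linear free_space k Iz -> Mk})
    (A0 A1 A2 : {linear Mk -> free_space k It})
    (B0 B1 : {linear Mk -> free_space k Iy}) (C : {linear Mk -> free_space k Iz}),
  [/\ forall m, m = jordan_sum x bt by_ bz (A0 m) (A1 m) (A2 m) (B0 m) (B1 m) (C m),
      forall a0 a1 a2 b0 b1 c m, m = jordan_sum x bt by_ bz a0 a1 a2 b0 b1 c ->
        [/\ A0 m = a0, A1 m = a1, A2 m = a2, B0 m = b0 & B1 m = b1 /\ C m = c],
      forall m : M, [/\ A0 (act h m) = A0 m, A1 (act h m) = A1 m + A0 m,
        A2 (act h m) = A2 m + A1 m, B0 (act h m) = B0 m &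
        B1 (act h m) = B1 m + B0 m /\ C (act h m) = C m],
      injective by_ /\ injective bz &
      forall d, x (x (by_ d)) = 0] /\ (forall d, x (bz d) = 0).
Proof.
move=> p3; have x3 := @xop3 M p3.
have [It [Iy [Iz [bt [by_ [bz [A0 [A1 [A2 [B0 [B1 [C [xxy xz mE coordE]]]]]]]]]]]]] :=
  jordan_coordinates x3.
exists It, Iy, Iz, bt, by_, bz, A0, A1, A2, B0, B1, C; split=> //; split=> //.
  move=> m.
  have xE : x m = jordan_sum x bt by_ bz 0 (A0 m) (A1 m) 0 (B0 m) 0.
    rewrite {1}(mE m) /jordan_sum !(linearD x) x3 xxy xz !(linear0 bt) !(linear0 by_).
    by rewrite (linear0 bz) !addr0 !add0r.
  have [E0 E1 E2 E3 [E4 E5]] := coordE _ _ _ _ _ _ _ xE.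
  rewrite xel_act; split; last split.
  - by apply: etrans (linearD A0 _ _) _; rewrite E0 addr0.
  - by apply: etrans (linearD A1 _ _) _; rewrite E1.
  - by apply: etrans (linearD A2 _ _) _; rewrite E2.
  - by apply: etrans (linearD B0 _ _) _; rewrite E3 addr0.
  - by apply: etrans (linearD B1 _ _) _; rewrite E4.
  - by apply: etrans (linearD C _ _) _; rewrite E5 addr0.
have byE d : by_ d = jordan_sum x bt by_ bz 0 0 0 d 0 0.
  rewrite /jordan_sum !(linear0 bt) !(linear0 by_) (linear0 bz).
  by rewrite !(linear0 x) !addr0 !add0r.
have bzE d : bz d = jordan_sum x bt by_ bz 0 0 0 0 0 d.
  rewrite /jordan_sum !(linear0 bt) !(linear0 by_).
  by rewrite !(linear0 x) !addr0 !add0r.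
split=> d d' dd'.
  have [_ _ _ E1 _] := coordE _ _ _ _ _ _ _ (byE d).
  by have [_ _ _ <- _] := coordE _ _ _ _ _ _ _ (byE d'); rewrite -E1 dd'.
have [_ _ _ _ [_ E1]] := coordE _ _ _ _ _ _ _ (bzE d).
by have [_ _ _ _ [_ <-]] := coordE _ _ _ _ _ _ _ (bzE d'); rewrite -E1 dd'.
Qed.

Definition finite_index (I : Type) := exists n (s : 'I_n -> I), bijective s.

Lemma finite_index_basis (I : Type) (b : {linear free_space k I -> Mk}) :
  injective b -> finite_dimensional M -> finite_index I.
Proof.
move=> b_inj [n [f fbij]].
apply: (@free_space_finite k n I (f \o b)) => d d' /(bij_inj fbij).
exact: b_inj.
Qed.

Lemma finite_index_sum (I J : Type) :
  finite_index I -> finite_index J -> finite_index (I + J).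
Proof.
move=> [n [s [s' sK s'K]]] [m [t [t' tK t'K]]]; exists (n + m)%N.
exists (fun i : 'I_(n + m) => match fintype.split i with inl a => inl (s a) | inr b => inr (t b) end).
exists (fun i => match i with inl a => lshift m (s' a) | inr b => rshift n (t' b) end).
  move=> i; case: (split_ordP i) => j ->.
    by rewrite sK.
  by rewrite tK.
case=> [a|b].
  rewrite /= (unsplitK (inl (s' a)) : fintype.split (lshift m (s' a)) = inl (s' a)).
  by rewrite s'K.
rewrite /= (unsplitK (inr (t' b)) : fintype.split (rshift n (t' b)) = inr (t' b)).
by rewrite t'K.
Qed.

(** The blocks of size 1 are the copies of k, and the blocks of size 2 form the projective
    complement. *)
Lemma split_sum_C2 : p = 2%N -> exists I : Type, split_sum obj I M /\
  (finite_dimensional M -> finite_index I).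
Proof.
move=> p2; have p3 : (p <= 3)%N by rewrite p2.
have [It [Iy [Iz [bt [by_ [bz [A0 [A1 [A2 [B0 [B1 [C H]]]]]]]]]]]] := jordan_module p3.
have [[mE coordE actE [_ bz_inj] xxy] xz] := H.
exists Iz; split; last exact: finite_index_basis bz_inj.
have x2 m : x (x m) = 0.
  by rewrite !xopE scalerA -expr2 -[in X in _ ^+ X]p2 xel_nilpotent scale0r.
(* Blocks of size 3 cannot occur: since x^2 = 0, the vector 0 has every [d] as its coordinate
   [A2]. *)
have free_t0 (d : free_space k It) : d = 0.
  have dE : 0 = jordan_sum x bt by_ bz 0 0 d 0 0 0.
    rewrite /jordan_sum !(linear0 bt) !(linear0 by_) (linear0 bz) x2.
    by rewrite !(linear0 x) !addr0.
  have [_ _ <- _ _] := coordE _ _ _ _ _ _ _ dE.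
  exact: (linear0 A2).
exists (fun=> trivial_module k gT); split; first by exists 0; exact: triv_suspension.
pose TX := direct_sum (fun _ : Iz => trivial_module k gT : lmodType kG).
have gfin m : finite_set [set i | (dval (C m) i : trivial_module k gT) != 0].
  exact: dsum_finite_supp.
pose g (m : M) : TX := sval (cid (dsum_mk (gfin m))).
have gE m i : dval (g m) i = dval (C m) i by rewrite /g; case: cid.
have g_lin : linear g.
  apply: cyclic_linear => [c u v|m]; apply: dsum_ext => i.
    rewrite dsumD dsumZ !gE.
    have -> : C ((c%:A : kG) *: u + v) = c *: C u + C v by exact: (linearP C).
    by congr (_ + _); rewrite scalar_triv.
  rewrite [RHS](act_triv h (dval (g m) i)) !gE.
  by have [_ _ _ _ [_ ->]] := actE m.
have PCfin (F : TX) : finite_set [set i | (dval F i : k^o) != 0].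
  exact: dsum_finite_supp.
pose PC (F : TX) : free_space k Iz := sval (cid (dsum_mk (M := fun=> k^o) (PCfin F))).
have PCE F i : dval (PC F) i = dval F i by rewrite /PC; case: cid.
pose f (F : TX) : M := bz (PC F).
have f_lin : linear f.
  apply: cyclic_linear => [c u v|F].
    rewrite /f; have -> : PC ((c%:A : kG) *: u + v) = c *: PC u + PC v.
      apply: dsum_ext => i; rewrite freeD freeZ !PCE dsumD dsumZ.
      by rewrite scalar_triv.
    exact: (linearP bz).
  rewrite /f [RHS]xel_act -xopE xz addr0; congr (bz _); apply: dsum_ext => i.
  by rewrite !PCE; exact: act_triv.
exists (mklin f_lin), (mklin g_lin); split.
  move=> F; rewrite !mklinE; apply: dsum_ext => i; rewrite gE /f.
  have zE : bz (PC F) = jordan_sum x bt by_ bz 0 0 0 0 0 (PC F).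
    rewrite /jordan_sum !(linear0 bt) !(linear0 by_).
    by rewrite !(linear0 x) !addr0 !add0r.
  have [_ _ _ _ [_ ->]] := coordE _ _ _ _ _ _ _ zE.
  exact: PCE.
have PCg m : PC (g m) = C m by apply: dsum_ext => i; rewrite PCE gE.
(* On the free module [kG] the identity is the trace of the evaluation at [1],
   which is [b0 - b1] in the basis [1, h - 1]. *)
have chi_lin : linear (fun m : Mk => by_ (B1 m - B0 m)).
  move=> c u v; rewrite (linearP B1) (linearP B0) -(linearP by_); congr (by_ _).
  by rewrite scalerBr opprD addrACA.
exists (fun m => by_ (B1 m - B0 m)); split; first exact: chi_lin.
move=> m; rewrite (trace_cyclic (fun m : M => by_ (B1 m - B0 m) : M)).
have hV : (h^-1 = h)%g.
  by rewrite -[LHS]mulg1 -expg_prime_order p2 expgS expg1 mulKg.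
have [_ _ _ EB0 [EB1 _]] := actE m.
rewrite p2 !big_ord_recl big_ord0 /= addr0 /bump expg0 expg1 invg1 !act1 hV.
rewrite EB0 EB1 addrK.
have addvv (v : M) : v + v = 0 by rewrite -mulr2n -[in LHS]p2 natp_scale.
have oppv (v : M) : - v = v by apply/eqP; rewrite eq_sym -addr_eq0 addvv.
have Em : m = by_ (B0 m) + xel *: (by_ (B1 m) : M) + bz (C m).
  rewrite {1}(mE m) /jordan_sum [A0 m]free_t0 [A1 m]free_t0 [A2 m]free_t0.
  by rewrite !(linear0 bt) !(linear0 x) !add0r.
transitivity (bz (C m) + (by_ (B0 m) + xel *: (by_ (B1 m) : M) + bz (C m)) : M).
  by rewrite /f PCg oppv -Em.
have -> : by_ (B1 m - B0 m) = by_ (B1 m) + by_ (B0 m) :> M.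
  by rewrite -[in RHS](oppv (by_ (B0 m))); exact: (linearB by_).
rewrite xel_act addrC -addrA addvv addr0.
by rewrite [RHS](AC (2*2) (2*4*(1*3))) /= addvv addr0.
Qed.

(** The summands are indexed by the blocks of sizes 2 and 1 together; those of size 3 form the
    projective complement. *)
Lemma split_sum_C3 : p = 3%N -> exists I : Type, split_sum obj I M /\
  (finite_dimensional M -> finite_index I).
Proof.
move=> p3'; have p3 : (p <= 3)%N by rewrite p3'.
have [It [Iy [Iz [bt [by_ [bz [A0 [A1 [A2 [B0 [B1 [C H]]]]]]]]]]]] := jordan_module p3.
have [[mE coordE actE [by_inj bz_inj] xxy] xz] := H.
exists (Iy + Iz)%type; split; last first.
  by move=> Mfd; apply: finite_index_sum; [exact: finite_index_basis by_inj Mfd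
                                        |exact: finite_index_basis bz_inj Mfd].
pose X (i : Iy + Iz) : lmodType kG :=
  match i with inl _ => E2 | inr _ => trivial_module k gT end.
exists X; split.
  by case=> i; [exists (Negz 0); exact: jordan2_suspension|exists 0; exact: triv_suspension].
pose G (m : M) (i : Iy + Iz) : X i := match i return X i with
  | inl a => jordan2 (dval (B0 m) a) (dval (B1 m) a)
  | inr b => dval (C m) b end.
have Gfin m : finite_set [set i | G m i != 0].
  pose S := ([set inl i | i in [set i | dval (B0 m) i != 0]] `|`
    [set inl i | i in [set i | dval (B1 m) i != 0]] `|`
    [set inr i | i in [set i | dval (C m) i != 0]])%classic : set (Iy + Iz).
  apply: (@sub_finite_set _ _ S); last first.
    by rewrite !finite_setU; do !split; exact/finite_image/dsum_finite_supp.
  case=> i /= Gi; last by right; exists i.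
  left; have [b0|b0] := eqVneq (dval (B0 m) i) 0; last by left; exists i.
  right; exists i => //=; apply: contraNN Gi => /eqP b1.
  by rewrite b0 b1 jordan2_00.
pose g (m : M) : direct_sum X := sval (cid (dsum_mk (Gfin m))).
have gE m i : dval (g m) i = G m i by rewrite /g; case: cid.
have g_lin : linear g.
  apply: cyclic_linear => [c u v|m]; apply: dsum_ext => i.
    rewrite dsumD dsumZ !gE.
    have E0 : B0 ((c%:A : kG) *: u + v) = c *: B0 u + B0 v by exact: (linearP B0).
    have E1 : B1 ((c%:A : kG) *: u + v) = c *: B1 u + B1 v by exact: (linearP B1).
    have EC : C ((c%:A : kG) *: u + v) = c *: C u + C v by exact: (linearP C).
    case: i => i; rewrite /G ?E0 ?E1 ?EC !freeD !freeZ; first exact: jordan2_lin.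
    by congr (_ + _); rewrite scalar_triv.
  have [_ _ _ EB0 [EB1 EC]] := actE m.
  have -> : dval (act h (g m)) i = act h (dval (g m) i) by [].
  rewrite !gE; case: i => i; rewrite /G ?EB0 ?EB1 ?EC; last by rewrite act_triv.
  by rewrite jordan2_act freeD.
have Pfin (F : direct_sum X) (T : Type) (s : T -> Iy + Iz) (w : forall i, X i -> k) :
    injective s -> (forall i, w i 0 = 0) ->
    finite_set [set i | w (s i) (dval F (s i)) != 0].
  move=> sinj w0.
  apply: (@sub_finite_set _ _ (s @^-1` [set i | dval F i != 0])%classic).
    by move=> i /=; apply: contraNN => /eqP ->; rewrite w0.
  by apply: finite_preimage => [u v _ _|]; [exact: sinj|exact: dsum_finite_supp].
pose w0 i : X i -> k := match i return X i -> k with inl _ => @pr0 | inr _ => fun=> 0 end.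
pose w1 i : X i -> k := match i return X i -> k with inl _ => @pr1 | inr _ => fun=> 0 end.
pose wz i : X i -> k := match i return X i -> k with inl _ => fun=> 0 | inr _ => id end.
have w00 i : w0 i 0 = 0 by case: i => // i; rewrite /= /pr0 !acoef0 subrr.
have w10 i : w1 i 0 = 0 by case: i => // i; rewrite /= /pr1 acoef0.
have wz0 i : wz i 0 = 0 by case: i.
have inl_inj : injective (@inl Iy Iz) by move=> u v [].
have inr_inj : injective (@inr Iy Iz) by move=> u v [].
pose P0 F : free_space k Iy := sval (cid (dsum_mk (M := fun=> k^o) (Pfin F _ _ _ inl_inj w00))).
pose P1 F : free_space k Iy := sval (cid (dsum_mk (M := fun=> k^o) (Pfin F _ _ _ inl_inj w10))).
pose PZ F : free_space k Iz := sval (cid (dsum_mk (M := fun=> k^o) (Pfin F _ _ _ inr_inj wz0))).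
have P0E F i : dval (P0 F) i = pr0 (dval F (inl i)) by rewrite /P0; case: cid.
have P1E F i : dval (P1 F) i = pr1 (dval F (inl i)) by rewrite /P1; case: cid.
have PZE F i : dval (PZ F) i = dval F (inr i) by rewrite /PZ; case: cid.
have P0l c u v : P0 ((c%:A : kG) *: u + v) = c *: P0 u + P0 v.
  by apply: dsum_ext => i; rewrite freeD freeZ !P0E dsumD dsumZ pr0_lin.
have P1l c u v : P1 ((c%:A : kG) *: u + v) = c *: P1 u + P1 v.
  by apply: dsum_ext => i; rewrite freeD freeZ !P1E dsumD dsumZ pr1_lin.
have PZl c u v : PZ ((c%:A : kG) *: u + v) = c *: PZ u + PZ v.
  apply: dsum_ext => i; rewrite freeD freeZ !PZE dsumD dsumZ.
  by congr (_ + _); rewrite scalar_triv.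
have P0h F : P0 (act h F) = P0 F.
  by apply: dsum_ext => i; rewrite !P0E; exact: pr0_act.
have P1h F : P1 (act h F) = P1 F + P0 F.
  by apply: dsum_ext => i; rewrite freeD !P1E P0E; exact: pr1_act.
have PZh F : PZ (act h F) = PZ F.
  by apply: dsum_ext => i; rewrite !PZE; exact: act_triv.
pose f0 (a b : free_space k Iy) (c : free_space k Iz) : Mk := by_ a + x (by_ b) + bz c.
pose f (F : direct_sum X) : M := f0 (P0 F) (P1 F) (PZ F).
have f0E a b c : f0 a b c = jordan_sum x bt by_ bz 0 0 0 a b c.
  by rewrite /jordan_sum !(linear0 bt) !(linear0 x) !add0r.
have f_lin : linear f.
  apply: cyclic_linear => [c u v|F].
    rewrite /f P0l P1l PZl !f0E -[0](addr0 (0 : free_space k It)).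
    rewrite -{1 3 5}(scaler0 _ c) jordan_sumP addr0.
    by [].
  rewrite /f [RHS]xel_act P0h P1h PZh -xopE /f0 !(linearD by_) !(linearD x).
  by rewrite xxy xz !addr0 -!addrA [bz _ + _]addrC.
exists (mklin f_lin), (mklin g_lin); split.
  move=> F; rewrite !mklinE; apply: dsum_ext => i; rewrite gE /f.
  have [_ _ _ E0 [E1 EC]] := coordE _ _ _ _ _ _ _ (f0E (P0 F) (P1 F) (PZ F)).
  case: i => i; rewrite /G ?E0 ?E1 ?EC ?PZE //.
  by rewrite P0E P1E jordan2K.
have P0g m : P0 (g m) = B0 m by apply: dsum_ext => i; rewrite P0E gE /= pr0K.
have P1g m : P1 (g m) = B1 m by apply: dsum_ext => i; rewrite P1E gE /= pr1K.
have PZg m : PZ (g m) = C m by apply: dsum_ext => i; rewrite PZE gE.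
(* On the free module [kG] the identity is the trace of the evaluation at [1],
   which is [a0 - a1 + a2] in the basis [1, h - 1, (h - 1)^2]. *)
pose chi (m : Mk) : Mk := bt (A0 m - A1 m + A2 m).
have chi_lin : linear chi.
  move=> c u v; rewrite /chi (linearP A0) (linearP A1) (linearP A2) -(linearP bt).
  congr (bt _); rewrite scalerDr scalerBr opprD [LHS](AC ((2*2)*2) ((1*3*5)*(2*4*6))).
  by [].
suff tr : is_trace [set: gT] (fun m : M => m - f (g m)).
  by apply: eq_is_trace (is_traceN tr) => m; rewrite opprB.
exists (chi : M -> M); split; first exact: chi_lin.
move=> m; rewrite (trace_cyclic (chi : M -> M)).
have h3 : (h * (h * h) = 1)%g by rewrite -expg_prime_order p3' !expgS expg0 mulg1.
have hV1 : (h^-1 = h * h)%g by rewrite -[LHS]mulg1 -h3 mulKg.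
have hV2 : ((h * h)^-1 = h)%g by rewrite -hV1 invgK.
have [EA0 EA1 EA2 _ _] := actE m.
have [EEA0 EEA1 EEA2 _ _] := actE (act h m).
have c1 : chi (act h m) = bt (A2 m).
  rewrite /chi EA0 EA1 EA2; congr (bt _).
  by rewrite opprD [A0 m + _]addrCA subrr addr0 [A2 m + _]addrC addKr.
have c2 : chi (act h (act h m)) = bt (A1 m + A2 m).
  rewrite /chi EEA0 EEA1 EEA2 EA0 EA1 EA2; congr (bt _).
  by rewrite opprD [A0 m + _]addrCA subrr addr0 [LHS]addrC addrK addrC.
rewrite p3' !big_ord_recl big_ord0 /= addr0 /bump expg0 expg1 expgS expg1 invg1.
rewrite !act1 hV1 hV2 !actM c1 c2 !xel_act.
have add3 (v : M) : v + v + v = 0.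
  by have := natp_scale v; rewrite p3' !mulrS mulr0n addr0 addrA.
rewrite {1}(mE m) /jordan_sum /f P0g P1g PZg /f0.
have -> : chi m = bt (A0 m) - bt (A1 m) + bt (A2 m).
  by rewrite /chi (linearD bt) (linearB bt).
rewrite (linearD bt) !xopE.
set u0 : M := bt (A0 m); set u1 : M := bt (A1 m); set u2 : M := bt (A2 m).
(* The trace is (u0 - u1 + u2) + (1 + x)(u1 + u2) + (1 + x)^2 u2, which is u0 + x u1 + x^2 u2 plus
   three times u2 + x u2. *)
transitivity (u0 + xel *: u1 + xel *: (xel *: u2)); first by rewrite -[X in X - _]addrA addrK.
rewrite !(scalerDr xel) !addrA.
rewrite [RHS](ACl ((1*6*11)*(2*4)*(3*5*8)*(7*9*10))) /=.
by rewrite !add3 addNr !addr0.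
Qed.

End Decomposition.
End Objects.
End CyclicOfPrimeOrder.

Lemma C2_C3_coproducts (k : fieldType) (gT : finGroupType) (p : nat)
    (obj : lmodType (group_algebra k gT) -> Prop) :
  prime p -> (p.-group [set: gT])%g -> p \in [pchar k] ->
  (forall N, obj N -> obj (coinduced gT (restrict_scalars N))) ->
  (forall N, finite_dimensional N -> obj N) ->
  ([set: gT] \isog Zp 2)%g \/ ([set: gT] \isog Zp 3)%g ->
  forall M, obj M ->
  (exists I : Type, coproduct_of_suspensions obj I M) /\
  (finite_dimensional M -> exists n, coproduct_of_suspensions obj 'I_n M).
Proof.
move=> p_pr pG kp obj_coind obj_fd isoC M objM.
have isogp (q : nat) : prime q -> ([set: gT] \isog Zp q)%g -> p = q.
  move=> q_pr /card_isog cG; move: pG.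
  by rewrite /pgroup cG card_Zp ?prime_gt0 // pnatE // => /eqP.
have p23 : p = 2%N \/ p = 3%N 
  by case: isoC => [/(isogp 2%N isT)|/(isogp 3%N isT)]; [left|right].
have cG : #|[set: gT]| = p.
  by case: isoC => iso; rewrite (card_isog iso) card_Zp // (isogp _ _ iso).
have [|h [lam [_ lamh lamM _]]] :=
    @additive_character k gT p p_pr kp [set: gT]%G 1%G (normal1 _).
  by rewrite indexg1 cG.
suff [I [IM Ifin]] : exists I : Type,
    split_sum obj I M /\ (finite_dimensional M -> finite_index I).
  split; first by exists I; exact: split_sum_coproduct.
  move=> /Ifin[n [s sbij]]; exists n; apply: split_sum_coproduct => //.
  exact: split_sum_reindex sbij IM.
case: p23 => [p2|p3].
  exact: (split_sum_C2 p_pr kp cG lamM lamh obj_fd M p2).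
exact: (split_sum_C3 p_pr kp cG lamM lamh obj_fd M p3).
Qed.

Theorem theorem3p1 (p : nat) (gT : finGroupType) (k : fieldType) :
  prime p ->
  (p.-group [set: gT])%g ->
  ([set: gT] != 1)%g ->
  p \in [pchar k]%R ->
  [<-> ([set: gT] \isog Zp 2)%g \/ ([set: gT] \isog Zp 3)%g;
       generating_hypothesis k gT;
       no_nontrivial_ghosts (StMod k gT);
       forall M : lmodType (group_algebra k gT), stmod k gT M ->
         exists n : nat, coproduct_of_suspensions (stmod k gT) 'I_n M;
       forall M : lmodType (group_algebra k gT), StMod k gT M ->
         exists I : Type, coproduct_of_suspensions (StMod k gT) I M].
Proof.
move=> p_pr pG G1 kp.
have cs N : stmod k gT N -> stmod k gT (coinduced gT (restrict_scalars N)).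
  exact: finite_dimensional_coind.
have cS N : StMod k gT N -> StMod k gT (coinduced gT (restrict_scalars N)) by [].
have fs N : finite_dimensional N -> stmod k gT N by [].
have fS N : finite_dimensional N -> StMod k gT N by [].
have C23s := @C2_C3_coproducts _ _ _ _ p_pr pG kp cs fs.
have C23S := @C2_C3_coproducts _ _ _ _ p_pr pG kp cS fS.
have GHs := @no_ghosts_C2_C3 _ _ _ _ p_pr pG G1 kp cs fs.
have GHS := @no_ghosts_C2_C3 _ _ _ _ p_pr pG G1 kp cS fS.
have cops : (forall M : lmodType (group_algebra k gT), stmod k gT M ->
    exists n : nat, coproduct_of_suspensions (stmod k gT) 'I_n M) ->
    no_nontrivial_ghosts (stmod k gT).
  move=> E; apply: coproducts_no_ghosts => // M Mfd.
  by have [n Mn] := E M Mfd; exists 'I_n.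
(* Every implication is routed through the first statement, where the group is known explicitly. *)
split.
  move=> C23; apply: cops => M Mfd.
  exact: (C23s C23 M Mfd).2.
split; first by move=> /GHs C23; apply: coproducts_no_ghosts => // M MS; case: (C23S C23 M MS).
split; first by move=> /GHS C23 M Mfd; exact: (C23s C23 M Mfd).2.
split; first by move=> /cops/GHs C23 M MS; case: (C23S C23 M MS).
by move=> E; apply/GHS/coproducts_no_ghosts.
Qed.
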